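(* Let $X=\{X_k\}_{k\in\mathbb{Z}}$ be a process with memory parameter $d_0\in\mathbb{R}$ and generalized spectral measure $\nu$, let $(\phi,\psi)$ be an admissible wavelet pair with parameters $(M,\alpha)$, $M>d_0-1/2$, let $W_{j,k}$ be the wavelet coefficients of $X$ and $\sigma_j^2(\nu)=\mathrm{Var}(W_{j,k})$. Assume that there exist $\beta>0$ and $\sigma^2>0$ such that $$\sup_{j\ge1}2^{\beta j}\left|\frac{\sigma_j^2(\nu)}{\sigma^2\,2^{2d_0j}}-1\right|<\infty\quad\text{and}\quad\sup_{n\ge1}\ \sup_{j=1,\dots,J_n}(1+n_j2^{-2j\beta})^{-1}n_j^{-1}\mathrm{Var}\left(\sum_{k=0}^{n_j-1}\frac{W_{j,k}^2}{\sigma_j^2(\nu)}\right)<\infty .$$ Let $\{L_n\}$ and $\{U_n\}$ be two sequences of integers with $0\le L_n<U_n\le J_n$ for all $n$, and suppose that, as $n\to\infty$, $$L_n^2\,(n2^{-L_n})^{-1/4}+L_n^{-1}\to0 .$$ Then the local Whittle wavelet estimator $\hat d_{\mathcal{I}_n(L_n,U_n)}$ is consistent, with rate given by $$\hat d_{\mathcal{I}_n(L_n,U_n)}=d_0+O_{\mathbb{P}}\left\{(n2^{-L_n})^{-1/2}+2^{-\beta L_n}\right\}.$$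
   Context: Process. $(\Delta X)_k=X_k-X_{k-1}$ and $\Delta^k$ is the $k$th order difference. $X$ has memory parameter $d_0$ with generalized spectral measure $\nu(d\lambda)=|1-e^{-i\lambda}|^{-2d_0}\nu^\ast(d\lambda)$ if for any integer $k\geq 0$ with $k>d_0-1/2$, $\Delta^kX$ is covariance stationary with spectral measure $|1-e^{-i\lambda}|^{2(k-d_0)}\nu^\ast(d\lambda)$ on $[-\pi,\pi]$, where $\nu^\ast$ is a nonnegative symmetric measure on $[-\pi,\pi]$ which, in a neighborhood of the origin, admits a positive and bounded density. Wavelets. Fourier transforms are $\hat\phi(\xi)=\int\phi(t)e^{-i\xi t}dt$, $\hat\psi(\xi)=\int\psi(t)e^{-i\xi t}dt$. A pair $(\phi,\psi)$ of real functions on $\mathbb{R}$ is an admissible wavelet pair with parameters $(M,\alpha)$ ($M\ge1$ integer, $\alpha>1$) if: $\phi,\psi$ are integrable with compact supports, $\hat\phi(0)=1$, $\int\psi^2=1$; $\sup_{\xi}|\hat\psi(\xi)|(1+|\xi|)^\alpha<\infty$; $\int t^l\psi(t)dt=0$ for $l=0,\dots,M-1$; and $t\mapsto\sum_{k\in\mathbb{Z}}k^l\phi(t-k)$ is a polynomial of degree $l$ for $l=0,\dots,M-1$. By convention the supports of $\phi$ and $\psi$ are included in $[-T,0]$ and $[0,T]$ respectively, for an integer $T\ge1$. Wavelet coefficients. $\psi_{j,k}(t)=2^{-j/2}\psi(2^{-j}t-k)$ and $W_{j,k}=\int_{\mathbb{R}}X(t)\psi_{j,k}(t)\,dt$, $j\ge0$,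 $k\in\mathbb{Z}$, with $X(t)=\sum_{k\in\mathbb{Z}}X_k\phi(t-k)$. Since $M>d_0-1/2$, for each $j$ the sequence $\{W_{j,k}\}_{k}$ is covariance stationary, so $\sigma_j^2(\nu)=\mathrm{Var}(W_{j,k})$ does not depend on $k$; wavelet coefficients are understood to be centered, $\mathbb{E}[W_{j,k}]=0$. For sample size $n$, $n_j=\max([2^{-j}(n-T+1)-T+1],0)$ ($[\cdot]$ = integer part), so that $W_{j,k}$, $0\le k<n_j$, depend only on $X_1,\dots,X_n$, and $J_n=\max\{j\ge0:n_j\ge1\}$ (suprema over empty index sets are void). Estimator. $\mathcal{I}_n(j_0,j_1)=\{(j,k):j_0\le j\le j_1,\ 0\le k<n_j\}$. For a finite set $\mathcal{I}$ of pairs $(j,k)$ with cardinality $|\mathcal{I}|$, $\langle\mathcal{I}\rangle=|\mathcal{I}|^{-1}\sum_{(j,k)\in\mathcal{I}}j$, and $$\hat d_{\mathcal{I}}=\mathop{\mathrm{Argmin}}_{d\in\mathbb{R}}\ \log\sum_{(j,k)\in\mathcal{I}}2^{2d(\langle\mathcal{I}\rangle-j)}W_{j,k}^2 .$$ *)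

(* Defs.v *)
From mathcomp Require Export all_boot all_order all_algebra.
From mathcomp Require Export finmap complex.
From mathcomp Require Export all_classical all_reals all_analysis.

Set Implicit Arguments.
Unset Strict Implicit.
Unset Printing Implicit Defensive.

Import Order.TTheory GRing.Theory Num.Theory.
Import numFieldNormedType.Exports.
Import ComplexField.Normc.

Local Open Scope classical_set_scope.
Local Open Scope ring_scope.

Section complex_valued.
Context {R : realType}.

(* e^{i x} *)
Definition cexp (x : R) : R[i] := (cos x +i* sin x)%C.

Definition cintegral (mu : {measure set (measurableTypeR R) -> \bar R})
    (D : set R) (f : R -> R[i]) : R[i] :=
  ((\int[mu]_(x in D) complex.Re (f x))
     +i* (\int[mu]_(x in D) complex.Im (f x)))%C.

Definition fourier (f : R -> R) (xi : R) : R[i] :=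
  cintegral lebesgue_measure setT (fun t => (f t)%:C%C * cexp (- (xi * t))).

End complex_valued.

Section memory.
Context {R : realType} {d : measure_display} {Omega : measurableType d}.
Variable P : probability Omega R.

Definition backward_diff (Y : int -> Omega -> R) : int -> Omega -> R :=
  fun k w => Y k w - Y (k - 1) w.

Definition covariance_stationary (Y : int -> Omega -> R) : Prop :=
  [/\ forall k, Y k \in Lfun P 2%:E,
      forall k l, ('E_P[Y k] = 'E_P[Y l])%E &
      forall k l h, covariance P (Y (k + h)) (Y k) =
                    covariance P (Y (l + h)) (Y l)].

(* Convention: Cov(Y_{k+h}, Y_k) = \int_{[-pi,pi]} e^{i h x} mu(dx), without a
   factor 1/(2 pi). *)
Definition has_spectral_measure (Y : int -> Omega -> R)
    (mu : {measure set (measurableTypeR R) -> \bar R}) : Prop :=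
  [/\ covariance_stationary Y,
      (mu setT < +oo)%E,
      mu (~` `[- pi, pi]) = 0%E &
      forall k h : int, (fine (covariance P (Y (k + h)) (Y k)))%:C%C =
        cintegral mu `[- pi, pi] (fun x => cexp (h%:~R * x))].

(* [mu] has a positive and bounded density on some neighbourhood of 0. *)
Definition pos_bounded_density_near0
    (mu : {measure set (measurableTypeR R) -> \bar R}) : Prop :=
  exists (e C : R) (f : R -> R),
    [/\ 0 < e,
        measurable_fun setT f,
        forall x, `|x| < e -> 0 < f x <= C &
        forall A : set (measurableTypeR R), measurable A ->
          A `<=` `]- e, e[ ->
          mu A = (\int[lebesgue_measure]_(x in A) (f x)%:E)%E].

(* X has memory parameter d0 and generalized spectral measure
   |1 - e^{-ix}|^{-2 d0} nustar(dx).  Where the exponent 2(k - d0) is negative,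
   the convention 0 `^ a = 0 is harmless: nustar has no atom at 0. *)
Definition has_memory_parameter (X : int -> Omega -> R) (d0 : R)
    (nustar : {measure set (measurableTypeR R) -> \bar R}) : Prop :=
  [/\ nustar (~` `[- pi, pi]) = 0%E,
      forall A : set (measurableTypeR R), measurable A ->
        nustar (-%R @` A) = nustar A,
      pos_bounded_density_near0 nustar &
      forall k : nat, d0 - 2^-1 < k%:R ->
        exists mu : {measure set (measurableTypeR R) -> \bar R},
          (forall A : set (measurableTypeR R), measurable A ->
             mu A = (\int[nustar]_(x in A)
               (normc (1 - cexp (- x)) `^ (2 * (k%:R - d0)))%:E)%E) /\
          has_spectral_measure (iter k backward_diff X) mu].

End memory.

Section wavelets.
Context {R : realType}.

(* The sums over int below have finite support because phi has compact
   support. *)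
Record admissible_wavelet_pair (phi psi : R -> R) (M : nat) (alpha : R)
    (T : nat) : Prop := AdmissibleWaveletPair {
  awp_M : (1 <= M)%N;
  awp_alpha : 1 < alpha;
  awp_T : (1 <= T)%N;
  awp_phi_int : lebesgue_measure.-integrable setT (EFin \o phi);
  awp_psi_int : lebesgue_measure.-integrable setT (EFin \o psi);
  awp_phi_supp : forall t, phi t != 0 -> - T%:R <= t <= 0;
  awp_psi_supp : forall t, psi t != 0 -> 0 <= t <= T%:R;
  awp_phi_hat0 : fourier phi 0 = 1;
  awp_psi_L2 : (\int[lebesgue_measure]_t ((psi t) ^+ 2)%:E = 1)%E;
  awp_psi_decay : (ereal_sup
    (range (fun xi => (normc (fourier psi xi) * (1 + `|xi|) `^ alpha)%:E))
      < +oo)%E;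
  awp_psi_moments : forall l, (l < M)%N ->
    \int[lebesgue_measure]_t (t ^+ l * psi t) = 0;
  awp_phi_poly : forall l, (l < M)%N -> exists p : {poly R},
    size p = l.+1 /\
    forall t, \sum_(k \in [set: int]) k%:~R ^+ l * phi (t - k%:~R) = p.[t]
}.

Definition psijk (psi : R -> R) (j : nat) (k : int) (t : R) : R :=
  2 `^ (- (j%:R / 2)) * psi (2^-1 ^+ j * t - k%:~R).

Context {d : measure_display} {Omega : measurableType d}.

Definition interpolation (X : int -> Omega -> R) (phi : R -> R) (w : Omega)
    (t : R) : R :=
  \sum_(k \in [set: int]) X k w * phi (t - k%:~R).

Definition wcoef (X : int -> Omega -> R) (phi psi : R -> R) (j : nat)
    (k : int) (w : Omega) : R :=
  \int[lebesgue_measure]_t (interpolation X phi w t * psijk psi j k t).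

(* By stationarity Var(W_{j,k}) does not depend on k; k = 0 is used. *)
Definition wvar (P : probability Omega R) (X : int -> Omega -> R)
    (phi psi : R -> R) (j : nat) : R :=
  fine ('V_P[wcoef X phi psi j 0])%E.

End wavelets.

(* [Num.truncn x] is max([x], 0). *)
Definition ncoef (T n j : nat) : nat :=
  Num.truncn (2^-1 ^+ j * (n%:R - T%:R + 1) - T%:R + 1 : rat).

(* Largest j with 1 <= ncoef T n j, and 0 if there is none.  For 1 <= T,
   restricting the range to j <= n loses nothing since 1 <= ncoef T n j implies
   2 ^ j <= n. *)
Definition Jmax (T n : nat) : nat :=
  (\max_(j < n.+1 | 1 <= ncoef T n j) j)%N.

Definition Iset (T n j0 j1 : nat) : {fset nat * nat} :=
  [fset p in [seq (j, k) | j <- index_iota j0 j1.+1,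
                           k <- index_iota 0 (ncoef T n j)]]%fset.

Section estimator.
Context {R : realType}.

Definition mean_scale (I : {fset nat * nat}) : R :=
  (#|` I|%fset)%:R^-1 * \sum_(p <- I) p.1%:R.

(* The sum is either positive for every theta or zero for every theta, so the
   junk value ln 0 = 0 (instead of -oo) does not affect the minimizers. *)
Definition contrast (I : {fset nat * nat}) (y : nat -> nat -> R) (theta : R)
    : R :=
  ln (\sum_(p <- I)
        2 `^ (2 * theta * (mean_scale I - p.1%:R)) * y p.1 p.2 ^+ 2).

Definition argmin (f : R -> R) : set R :=
  [set x | forall x', f x <= f x'].

Context {d : measure_display} {Omega : measurableType d}.

(* [dhat] is a version of the estimator: the minimizer whenever one exists, any
   value otherwise (degenerate samples only). *)
Definition local_whittle (I : {fset nat * nat}) (W : nat -> int -> Omega -> R)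
    (dhat : Omega -> R) : Prop :=
  forall w, let f := contrast I (fun j k => W j k%:Z w) in
    argmin f !=set0 -> argmin f (dhat w).

(* Probabilities of events involving [Z] are bounded through a measurable
   cover, which reduces to the usual definition for measurable [Z n] and does
   not require the measurability of the estimator. *)
Definition proba_le (P : probability Omega R) (A : set Omega) (e : R) : Prop :=
  exists B, [/\ measurable B, A `<=` B & (P B <= e%:E)%E].

Definition cvg_proba (P : probability Omega R) (Z : nat -> Omega -> R) (l : R)
    : Prop :=
  forall eta e : R, 0 < eta -> 0 < e ->
    \forall n \near \oo, proba_le P [set w | eta < `|Z n w - l|] e.

(* Z_n = O_P(r_n) *)
Definition bigO_proba (P : probability Omega R) (Z : nat -> Omega -> R)
    (r : nat -> R) : Prop :=
  forall e : R, 0 < e -> exists2 C : R, 0 < C &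
    \forall n \near \oo, proba_le P [set w | C * r n < `|Z n w|] e.

End estimator.

(* Main.v *)
Require Import Defs.
From mathcomp Require Import measurable_realfun ring lra zify.
Import Order.TTheory GRing.Theory Num.Theory.
Import numFieldNormedType.Exports.
Local Open Scope classical_set_scope.
Local Open Scope ring_scope.

(* Put theta = d0 + x.  Up to constants the contrast is the logarithm of
   sum_j B_j 2^(2x(m - j)), where m is the mean scale and B_j is the empirical
   energy of scale j normalized so that it concentrates around n_j.  Since
   sum_j n_j (m - j) = 0, the inequality e^z >= 1 + z + min(|z|/2, z^2/4), used
   with its last term for the finest scale L only, shows that the contrast at
   d0 + x exceeds the contrast at d0 as soon as |x| dominates
   (n 2^-L)^-1 sum_j (4 + j - L) |B_j - n_j|.  This gives both the existence of
   minimizers and their location, without a preliminary consistency proof.  The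
   two hypotheses bound E (B_j - n_j)^2 by a constant times
   (n_j^(1/2) + n_j 2^(-beta j))^2; these bounds sum geometrically in j, and
   Markov's inequality gives the rate.

   The bias hypothesis concerns k = 0 only, so E W_{j,k}^2 = sigma_j^2 requires
   stationarity in k: W_{j,k} is a finite filter of X with M vanishing moments,
   hence a finite filter of Delta^M X.  To expand W_{j,k} linearly one needs
   phi(. - l) psi_{j,k} to be integrable; phi being only integrable, psi has to
   be essentially bounded.  This follows from the integrability of its Fourier
   transform by Fejer summation and Lebesgue differentiation. *)

Set Implicit Arguments.
Unset Strict Implicit.
Unset Printing Implicit Defensive.

(** * Affine changes of variables *)

Section affine_change_of_variables.
Context {R : realType}.
Notation mu := (@lebesgue_measure R).
Variables (s c : R).
Hypothesis s_gt0 : 0 < s.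

Let h (x : measurableTypeR R) : measurableTypeR R := s * x + c.

Let mh : measurable_fun setT h.
Proof.
apply: measurable_funD => //; exact: measurable_funM.
Qed.

(* The measure structure of a pushforward is not inferred: it needs [mh]. *)
Let nu := mscale (NngNum (ltW s_gt0))
  (measure_function_pushforward__canonical__measure_function_Measure mu mh).

(** The image of [mu] under [h] gives []a, b]] the mass [(b - a) / s], which the factor [s]
    corrects; uniqueness of Lebesgue measure extends this from half-open intervals to all measurable
    sets. *)
Let pushforward_affine (A : set (measurableTypeR R)) :
  measurable A -> mu A = nu A.
Proof.
move=> mA; apply: (@lebesgue_measure_unique _ nu) => // _ [[a b] _ <-].
rewrite /nu/= /mscale/= /pushforward.
have -> : h @^-1` `]a, b] = `](a - c) / s, (b - c) / s]%classic.
  apply/seteqP; split=> x /=; rewrite /h !in_itv/= ltr_pdivrMr// ler_pdivlMr//;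
  by rewrite ltrBlDr lerBrDr mulrC.
rewrite !lebesgue_measure_itv/= !lte_fin ltr_pM2r ?invr_gt0// ltrD2r.
case: ifPn => ab; last by rewrite mule0.
rewrite -!EFinD -EFinM; congr EFin; field.
by rewrite gt_eqF.
Qed.

Let ge0_integral_affine (f : R -> \bar R) : measurable_fun setT f ->
  (forall x, 0 <= f x)%E ->
  (\int[mu]_x f x = s%:E * \int[mu]_x f (s * x + c)%R)%E.
Proof.
move=> mf f0.
rewrite (@eq_measure_integral _ _ _ _ nu); last first.
  by move=> A mA _; exact: pushforward_affine.
rewrite /nu ge0_integral_mscale//.
by rewrite ge0_integral_pushforward.
Qed.

Lemma integrable_affine (f : R -> R) :
  mu.-integrable setT (EFin \o f) ->
  mu.-integrable setT (EFin \o (fun x => f (s * x + c))).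
Proof.
move=> /integrableP[mf fi]; apply/integrableP; split.
  by apply: (measurableT_comp mf).
move: fi; rewrite ge0_integral_affine//; last exact: measurableT_comp.
(* The transformed integral cannot be [+oo]: multiplied by [s > 0] it would stay infinite. *)
rewrite /=; case: (integral _ _ _) => [r _||]; rewrite ?ltry//.
by rewrite mulry gtr0_sg// mul1e.
Qed.

Lemma Rintegral_affine (f : R -> R) :
  mu.-integrable setT (EFin \o f) ->
  \int[mu]_x f (s * x + c) = s^-1 * \int[mu]_x f x.
Proof.
move=> fi; have /integrableP[mf _] := fi.
have sN0 : s != 0 by rewrite gt_eqF.
have fai := integrable_affine fi.
suff E : (\int[mu]_x (f x)%:E = s%:E * \int[mu]_x (f (s * x + c)%R)%:E)%E.
  rewrite /Rintegral E fineM//; last exact: integrable_fin_num fai.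
  by rewrite mulrA mulVf// mul1r.
pose g (x : R) := f (s * x + c).
have pE : (\int[mu]_x (EFin \o f)^\+ x =
    s%:E * \int[mu]_x (EFin \o g)^\+ x)%E.
  rewrite ge0_integral_affine//; last exact: measurable_funepos.
  by congr (_ * _)%E; apply: eq_integral => x _; rewrite !funeposE.
have nE : (\int[mu]_x (EFin \o f)^\- x =
    s%:E * \int[mu]_x (EFin \o g)^\- x)%E.
  rewrite ge0_integral_affine//; last exact: measurable_funeneg.
  by congr (_ * _)%E; apply: eq_integral => x _; rewrite !funenegE.
rewrite [LHS]integralE [in RHS](@integralE _ _ _ mu setT (EFin \o g)).
by rewrite pE nE (muleBr _ (integrable_add_def measurableT fai)).
Qed.

End affine_change_of_variables.

(** * Fejer kernel *)

Section fejer.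
Context {R : realType}.
Implicit Types (n m : nat) (v : R).

(** A sum of Dirichlet kernels of orders below [n], that is, [n] times the usual Fejer kernel. *)
Definition fejer_kernel n v : R :=
  \sum_(k < n) (1 + 2 * \sum_(m < k) cos (m.+1%:R * v)).

(** The antiderivative of [fejer_kernel] vanishing at 0. Written termwise, its pairing with a
    function only involves sine and cosine transforms. *)
Definition fejer_primitive n v : R :=
  \sum_(k < n) (v + 2 * \sum_(m < k) m.+1%:R^-1 * sin (m.+1%:R * v)).

(* Fejer's closed form, multiplied out so as to hold where cos v = 1 too. *)
Lemma fejer_kernelE n v :
  (1 - cos v) * fejer_kernel n v = 1 - cos (n%:R * v).
Proof.
have dirichlet k : (1 - cos v) * (1 + 2 * \sum_(m < k) cos (m.+1%:R * v)) =
    cos (k%:R * v) - cos (k.+1%:R * v).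
  elim: k => [|k IH].
    by rewrite big_ord0 mul0r mul1r mulr0 addr0 mulr1 cos0.
  rewrite big_ord_recr/= (mulrDr 2) addrA mulrDr {}IH.
  have -> : k.+2%:R * v = k.+1%:R * v + v by rewrite -[in LHS]natr1; ring.
  have -> : k%:R * v = k.+1%:R * v - v by rewrite -[in RHS]natr1; ring.
  by rewrite cosB cosD; ring.
elim: n => [|n IH]; first by rewrite /fejer_kernel big_ord0 mul0r cos0; ring.
by rewrite /fejer_kernel big_ord_recr/= mulrDr IH dirichlet; ring.
Qed.

Lemma fejer_primitive0 n : fejer_primitive n 0 = 0.
Proof.
rewrite /fejer_primitive big1// => k _.
by rewrite big1 ?mulr0 ?addr0// => m _; rewrite mulr0 sin0 mulr0.
Qed.

Lemma fejer_primitiveN n v : fejer_primitive n (- v) = - fejer_primitive n v.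
Proof.
rewrite /fejer_primitive -sumrN; apply: eq_bigr => k _.
rewrite opprD -mulrN -sumrN; congr (_ + _ * _); apply: eq_bigr => m _.
by rewrite mulrN sinN mulrN.
Qed.

Lemma sin_natmul_pi n : sin (n%:R * pi) = 0 :> R.
Proof.
elim: n => [|n IH]; first by rewrite mul0r sin0.
by rewrite -natr1 mulrDl mul1r sinDpi IH oppr0.
Qed.

Lemma fejer_primitive_pi n : fejer_primitive n pi = n%:R * pi.
Proof.
rewrite /fejer_primitive (eq_bigr (fun=> pi)) => [|k _].
  by rewrite big_const_ord iter_addr_0 mulr_natl.
by rewrite big1 ?mulr0 ?addr0// => m _; rewrite sin_natmul_pi mulr0.
Qed.

Lemma is_derive_fejer_primitive n v :
  is_derive v 1 (fejer_primitive n) (fejer_kernel n v).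
Proof.
have -> : fejer_primitive n = \sum_(k < n) (fun x =>
    x + 2 * \sum_(m < k) m.+1%:R^-1 * sin (m.+1%:R * x)).
  by apply/funext => x; rewrite /fejer_primitive fct_sumE.
apply: is_derive_sum => k.
apply: is_deriveD.
have -> : (fun x : R => 2 * \sum_(m < k) m.+1%:R^-1 * sin (m.+1%:R * x)) =
    2 *: \sum_(m < k) (fun x => m.+1%:R^-1 * sin (m.+1%:R * x)).
  by apply/funext => x; rewrite fctE fct_sumE.
apply: is_deriveZ; apply: is_derive_sum => m.
apply: is_derive_eq.
by rewrite /GRing.scale/= mulr1 mulrCA mulVf ?mulr1// pnatr_eq0.
Qed.

(** By the closed form the kernel is nonnegative wherever [cos < 1]; the mean value theorem does the
    rest. *)
Lemma fejer_primitive_incr n (x y : R) : 0 <= x -> x < y -> y <= pi ->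
  0 <= fejer_primitive n y - fejer_primitive n x.
Proof.
move=> x0 xy ypi.
have [z||c /[!in_itv]/= /andP[xc cy] ->] := @MVT _ (fejer_primitive n)
    (fejer_kernel n) x y xy.
- by move=> _; exact: is_derive_fejer_primitive.
- apply: derivable_within_continuous => z _.
  exact: (@ex_derive _ _ _ _ _ _ _ (is_derive_fejer_primitive n z)).
rewrite mulr_ge0 ?subr_ge0 ?(ltW xy)//.
have cc : cos c < 1.
  rewrite -cos0 ltr_cos// ?in_itv/= ?lexx ?pi_ge0//; lra.
have : 0 <= (1 - cos c) * fejer_kernel n c.
  by rewrite fejer_kernelE subr_ge0; have := cos_max (n%:R * c);
    rewrite ler_norml => /andP[].
by rewrite pmulr_rge0// subr_gt0.
Qed.

(** Away from 0 the kernel is at most [2 / (1 - cos x)]. The bound is uniform in [n], so it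
    disappears after division by [n.+1]. *)
Lemma fejer_primitive_le n (x y : R) : 0 < x -> x < y -> y <= pi ->
  fejer_primitive n y - fejer_primitive n x <= 2 * (y - x) / (1 - cos x).
Proof.
move=> x0 xy ypi.
have [z||c /[!in_itv]/= /andP[xc cy] ->] := @MVT _ (fejer_primitive n)
    (fejer_kernel n) x y xy.
- by move=> _; exact: is_derive_fejer_primitive.
- apply: derivable_within_continuous => z _.
  exact: (@ex_derive _ _ _ _ _ _ _ (is_derive_fejer_primitive n z)).
have cx : cos x < 1.
  rewrite -cos0 ltr_cos// ?in_itv/= ?lexx ?pi_ge0//; lra.
have cc : cos c < cos x by rewrite ltr_cos// ?in_itv/=; lra.
have c1 : 0 < 1 - cos c by lra.
rewrite mulrAC ler_wpM2r ?subr_ge0 ?(ltW xy)//.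
rewrite -(ler_pM2l c1) fejer_kernelE.
have := cos_max (n%:R * c); rewrite ler_norml => /andP[k1 _].
apply: (@le_trans _ _ 2); first lra.
rewrite mulrCA ler_peMr// ler_pdivlMr; lra.
Qed.

(** A smooth approximation of [pi] times the sign function on [[-pi, pi]]. *)
Definition fejer_step n v : R := n.+1%:R^-1 * fejer_primitive n.+1 v.

Lemma fejer_stepN n v : fejer_step n (- v) = - fejer_step n v.
Proof. by rewrite /fejer_step fejer_primitiveN mulrN. Qed.

(** The primitive increases from 0 to [n.+1 * pi] on [[0, pi]], and it is odd. This bound provides
    the domination when [n] tends to infinity. *)
Lemma fejer_step_norm_le n v : `|v| <= pi -> `|fejer_step n v| <= pi.
Proof.
wlog v0 : v / 0 <= v => [wl vpi|].
  have [/wl/(_ vpi)//|/ltW v0] := leP 0 v.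
  by rewrite -normrN -fejer_stepN wl ?normrN// oppr_ge0.
rewrite ger0_norm// => vpi.
have [->|vN0] := eqVneq v 0;
  first by rewrite /fejer_step fejer_primitive0 mulr0 normr0 pi_ge0.
have v1 : 0 < v by rewrite lt_neqAle eq_sym vN0.
have G0 : 0 <= fejer_primitive n.+1 v.
  by have := @fejer_primitive_incr n.+1 0 v (lexx _) v1 vpi;
    rewrite fejer_primitive0 subr0.
rewrite /fejer_step ger0_norm ?mulr_ge0 ?invr_ge0//.
rewrite mulrC ler_pdivrMr// mulrC -fejer_primitive_pi.
have [->//|vNpi] := eqVneq v pi.
by rewrite -subr_ge0 fejer_primitive_incr// lt_neqAle vNpi.
Qed.

Lemma cvg_fejer_step v : 0 < v <= pi -> fejer_step n v @[n --> \oo] -->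
  (pi : R).
Proof.
move=> /andP[v0 vpi].
have [->|vNpi] := eqVneq v pi.
  rewrite (_ : (fun n => _) = cst pi); first exact: cvg_cst.
  by apply/funext => n; rewrite /fejer_step fejer_primitive_pi mulKf.
have v1 : v < pi by rewrite lt_neqAle vNpi.
have cx : cos v < 1.
  rewrite -cos0 ltr_cos// ?in_itv/= ?lexx ?pi_ge0//; lra.
pose C := 2 * (pi - v) / (1 - cos v).
have cC : (pi - n.+1%:R^-1 * C) @[n --> \oo] --> (pi : R).
  rewrite -[X in _ --> X]subr0 -[X in _ - X](mul0r C).
  apply: cvgB; first exact: cvg_cst.
  by apply: cvgMl; exact: cvg_harmonic.
apply: squeeze_cvgr cC (cvg_cst (pi : R)).
apply: nearW => n; apply/andP; split; last first.
  by have := @fejer_step_norm_le n v;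
    rewrite gtr0_norm// => /(_ vpi)/(le_trans (ler_norm _)).
rewrite lerBlDr /fejer_step -mulrDr mulrC ler_pdivlMr// mulrC
  -fejer_primitive_pi.
by rewrite -lerBlDl /C fejer_primitive_le.
Qed.

Lemma cvg_fejer_step_sg v : `|v| <= pi ->
  fejer_step n v @[n --> \oo] --> Num.sg v * pi.
Proof.
move=> vpi; have [v0|v0|->] := ltrgt0P v.
- rewrite gtr0_sg// mul1r; apply: cvg_fejer_step.
  by rewrite v0 -(gtr0_norm v0).
- rewrite ltr0_sg// mulN1r -[v]opprK; under eq_fun do rewrite fejer_stepN.
  by apply: cvgN; apply: cvg_fejer_step; rewrite oppr_gt0 v0 -(ltr0_norm v0).
- rewrite sgr0 mul0r (_ : (fun n => _) = cst 0); first exact: cvg_cst.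
  by apply/funext => n; rewrite /fejer_step fejer_primitive0 mulr0.
Qed.

End fejer.

(** * Functions with decaying Fourier transform *)

Section decay_estimates.
Context {R : realType}.

(** Comparison with the integral of [(1 + om * x) ^ (- alpha)], in discrete form: each term is at
    most a multiple of an increment of the antiderivative [p], and the increments telescope. The
    termwise bound comes from [ln (w / u) >= 1 - u / w] and [expR y >= 1 + y]. *)
Lemma sum_powR_le (om alpha : R) n : 0 < om -> 1 < alpha ->
  \sum_(m < n) (1 + om * m.+1%:R) `^ (- alpha) <= (om * (alpha - 1))^-1.
Proof.
move=> om0 a1.
pose p (m : nat) : R := (1 + om * m%:R) `^ (1 - alpha).
have u0 m : 0 < 1 + om * m%:R by rewrite ltr_pwDl// mulr_ge0// ltW.
have oma : 0 < om * (alpha - 1) by rewrite mulr_gt0// subr_gt0.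
have key m : om * (alpha - 1) * (1 + om * m.+1%:R) `^ (- alpha) <= p m - p m.+1.
  rewrite /p; set u := 1 + om * m%:R; set w := 1 + om * m.+1%:R.
  have [up wp] : 0 < u /\ 0 < w by split; exact: u0.
  have wu : w = u + om by rewrite /w /u -natr1; ring.
  have -> : w `^ (- alpha) = w `^ (1 - alpha) / w.
    rewrite -powR_inv1 ?ltW// -powRD ?(gt_eqF wp) ?implybT//.
    by congr (_ `^ _); ring.
  have -> : u `^ (1 - alpha) = w `^ (1 - alpha) * expR ((alpha - 1) * ln
    (w / u)).
    rewrite /powR !gt_eqF// -expRD lnM ?posrE ?invr_gt0// lnV ?posrE//.
    congr expR; ring.
  have lnwu : om / w <= ln (w / u).
    have uw1 : 1 + (u / w - 1) = u / w by ring.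
    have : ln (u / w) <= u / w - 1.
      by rewrite -[X in ln X]uw1 le_ln1Dx// ltrBDl subrr divr_gt0.
    rewrite !lnM ?posrE ?invr_gt0// !lnV ?posrE// => h.
    have -> : om / w = 1 - u / w by rewrite wu; field; rewrite -wu gt_eqF.
    lra.
  have : 1 + (alpha - 1) * (om / w) <= expR ((alpha - 1) * ln (w / u)).
    by apply: le_trans (expR_ge1Dx _); rewrite lerD2l ler_wpM2l// subr_ge0 ltW.
  have := powR_ge0 w (1 - alpha); set q := w `^ _; set e := expR _ => q0 h.
  have -> : om * (alpha - 1) * (q / w) = q * ((alpha - 1) * (om / w)) by ring.
  rewrite (_ : q * e - q = q * (e - 1)); last ring.
  by rewrite ler_wpM2l// lerBrDl.
rewrite -[leRHS]mulr1 -ler_pdivrMl ?invr_gt0// invrK mulr_sumr.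
apply: (@le_trans _ _ (\sum_(i < n) (p i - p i.+1))).
  by apply: ler_sum => i _.
have -> : \sum_(i < n) (p i - p i.+1) = p 0%N - p n.
  elim: n => [|n IH]; first by rewrite big_ord0 subrr.
  by rewrite big_ord_recr/= IH; ring.
by rewrite /p mulr0 addr0 powR1 gerBl powR_ge0.
Qed.

Lemma sin_lipschitz (x y : R) : `|sin x - sin y| <= `|x - y|.
Proof.
wlog xy : x y / y <= x => [wl|].
  have [/wl//|/ltW/wl] := leP y x; by rewrite distrC (distrC y).
have [|z _ ->] := @MVT_segment _ sin cos y x xy.
  by apply: derivable_within_continuous => z _; exact: derivable_sin.
by rewrite normrM ler_piMl// cos_max.
Qed.

Lemma cos_lipschitz (x y : R) : `|cos x - cos y| <= `|x - y|.
Proof.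
wlog xy : x y / y <= x => [wl|].
  have [/wl//|/ltW/wl] := leP y x; by rewrite distrC (distrC y).
have [|z _ ->] := @MVT_segment _ cos (fun z => - sin z) y x xy.
  by apply: derivable_within_continuous => z _; exact: derivable_cos.
by rewrite normrM normrN ler_piMl// sin_max.
Qed.

End decay_estimates.

Section fourier_bound.
Context {R : realType}.
Notation mu := (@lebesgue_measure R).
Variables (f : R -> R) (S alpha C : R).
Hypothesis f_int : mu.-integrable setT (EFin \o f).
Hypothesis f_supp : forall t, f t != 0 -> 0 <= t <= S.
Hypothesis alpha_gt1 : 1 < alpha.
Hypothesis f_cos : forall xi, 0 <= xi ->
  `|\int[mu]_t (f t * cos (xi * t))| <= C * (1 + xi) `^ (- alpha).
Hypothesis f_sin : forall xi, 0 <= xi ->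
  `|\int[mu]_t (f t * sin (xi * t))| <= C * (1 + xi) `^ (- alpha).

Lemma integrableM_bounded (h : R -> R) (k : R) : measurable_fun setT h ->
  (forall t, 0 <= t <= S -> `|h t| <= k) ->
  mu.-integrable setT (EFin \o (fun t => f t * h t)).
Proof.
move=> mh hk.
apply: (@le_integrable _ _ _ mu setT measurableT _ (EFin \o (fun t =>
  k * f t))).
- apply/measurable_EFinP/measurable_funM => //.
  by apply/measurable_EFinP; case/integrableP: f_int.
- move=> t _ /=; rewrite lee_fin !normrM mulrC.
  have [->|/f_supp/hk hkt] := eqVneq (f t) 0; first by rewrite normr0 !mulr0.
  by rewrite ler_wpM2r// (le_trans hkt)// ler_norm.
- exact: (integrableZl measurableT k f_int).
Qed.

(** Integrability travels with the bound so that bounds on the pairing with [f] can be added and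
    scaled along a trigonometric polynomial. *)
Let test_le (h : R -> R) (k : R) :=
  mu.-integrable setT (EFin \o (fun t => f t * h t)) /\
  `|\int[mu]_t (f t * h t)| <= k.

Let test_leD (g h : R -> R) j k : test_le g j -> test_le h k ->
  test_le (fun t => g t + h t) (j + k).
Proof.
move=> [ig lg] [ih lh]; rewrite /test_le.
rewrite (_ : (fun t => _) = (fun t => f t * g t + f t * h t)); last first.
  by apply/funext => t; rewrite mulrDr.
split; first exact: (integrableD measurableT ig ih).
by rewrite RintegralD// (le_trans (ler_normD _ _))// lerD.
Qed.

Let test_leZ (h : R -> R) c k : 0 <= c -> test_le h k ->
  test_le (fun t => c * h t) (c * k).
Proof.
move=> c0 [ih lh]; rewrite /test_le.
rewrite (_ : (fun t => _) = (fun t => c * (f t * h t))); last first.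
  by apply/funext => t; rewrite mulrCA.
split; first exact: (integrableZl measurableT c ih).
by rewrite RintegralZl// normrM ger0_norm// ler_wpM2l.
Qed.

Let test_le_sum n (h : nat -> R -> R) (k : nat -> R) :
  (forall i, test_le (h i) (k i)) ->
  test_le (fun t => \sum_(i < n) h i t) (\sum_(i < n) k i).
Proof.
move=> hk; elim: n => [|n IH].
  rewrite big_ord0 /test_le (_ : (fun t => _) = cst 0); last first.
    by apply/funext => t; rewrite big_ord0 mulr0.
  split; first exact: integrable0.
  by rewrite Rintegral_cst// mul0r normr0.
rewrite big_ord_recr/=; under eq_fun do rewrite big_ord_recr/=.
exact: test_leD.
Qed.

(** The addition formula separates [t] from the endpoints. The endpoint factors are at most
    [xi * (b - a)] by the Lipschitz bounds, and the remaining integrals are the transforms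
    controlled by hypothesis. *)
Let test_le_sin xi a b : 0 <= xi -> a <= b ->
  test_le (fun t => sin (xi * (b - t)) - sin (xi * (a - t)))
    (xi * (b - a) * (2 * C * (1 + xi) `^ (- alpha))).
Proof.
move=> xi0 ab.
have ic : mu.-integrable setT (EFin \o (fun t => f t * cos (xi * t))).
  apply: (@integrableM_bounded _ 1) => [|t _]; last exact: cos_max.
  apply: measurableT_comp; last exact: measurable_funM.
  by apply: continuous_measurable_fun => x; exact: continuous_cos.
have isin : mu.-integrable setT (EFin \o (fun t => f t * sin (xi * t))).
  apply: (@integrableM_bounded _ 1) => [|t _]; last exact: sin_max.
  apply: measurableT_comp; last exact: measurable_funM.
  by apply: continuous_measurable_fun => x; exact: continuous_sin.
pose p := sin (xi * b) - sin (xi * a).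
pose q := cos (xi * b) - cos (xi * a).
have E t : f t * (sin (xi * (b - t)) - sin (xi * (a - t))) =
    p * (f t * cos (xi * t)) - q * (f t * sin (xi * t)).
  by rewrite !mulrBr !sinB /p /q; ring.
have ipc : mu.-integrable setT (EFin \o (fun t => p * (f t * cos (xi * t)))).
  exact: (integrableZl measurableT p ic).
have iqs : mu.-integrable setT (EFin \o (fun t => q * (f t * sin (xi * t)))).
  exact: (integrableZl measurableT q isin).
have pq x y : `|x| <= `|xi * b - xi * a| ->
    `|y| <= C * (1 + xi) `^ (- alpha) ->
    `|x * y| <= xi * (b - a) * (C * (1 + xi) `^ (- alpha)).
  rewrite -mulrBr (ger0_norm (mulr_ge0 _ _)) ?subr_ge0// => hx hy.
  by rewrite normrM ler_pM.
rewrite /test_le (_ : (fun t => _) =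
  (fun t => p * (f t * cos (xi * t)) - q * (f t * sin (xi * t)))); last first.
  by apply/funext => t; rewrite E.
split; first exact: (integrableB measurableT ipc iqs).
rewrite RintegralB// !RintegralZl//.
apply: (le_trans (ler_normB _ _)).
rewrite (_ : _ * _ = xi * (b - a) * (C * (1 + xi) `^ (- alpha)) +
  xi * (b - a) * (C * (1 + xi) `^ (- alpha))); last ring.
apply: lerD; apply: pq;
  [exact: sin_lipschitz|exact: f_cos|exact: cos_lipschitz|exact: f_sin].
Qed.

Let test_le_weaken (h : R -> R) j k : j <= k -> test_le h j -> test_le h k.
Proof. by move=> jk [ih lh]; split=> //; exact: le_trans jk. Qed.

Let test_le_cst c : 0 <= c -> test_le (fun=> c) (c * `|\int[mu]_t f t|).
Proof.
move=> c0; rewrite /test_le.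
rewrite (_ : (fun t => _) = (fun t => c * f t)); last first.
  by apply/funext => t; rewrite mulrC.
split; first exact: (integrableZl measurableT c f_int).
by rewrite RintegralZl// normrM ger0_norm.
Qed.

Let C_ge0 : 0 <= C.
Proof.
by have := f_cos (lexx 0); rewrite addr0 powR1 mulr1; exact: le_trans.
Qed.

Let B om := om * (`|\int[mu]_t f t| + 4 * C / (om * (alpha - 1))).

(** The linear parts of the two primitives differ by the constant [om * (b - a)]. In the other terms
    [m.+1%:R^-1] cancels the frequency produced by [test_le_sin], and [alpha > 1] makes the sum
    converge. The resulting bound is independent of [n] and linear in [b - a]. *)
Let test_le_fejer n a b om : 0 < om -> a <= b ->
  test_le (fun t => fejer_step n (om * (b - t)) - fejer_step n (om * (a - t)))
    (B om * (b - a)).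
Proof.
move=> om0 ab.
have ba0 : 0 <= b - a by rewrite subr_ge0.
pose h (m : nat) t := m.+1%:R^-1 *
  (sin (m.+1%:R * om * (b - t)) - sin (m.+1%:R * om * (a - t))).
pose k (m : nat) := om * (b - a) * (2 * C * (1 + om * m.+1%:R) `^ (- alpha)).
have hk m : test_le (h m) (k m).
  have mom : 0 <= m.+1%:R * om by rewrite mulr_ge0// ltW.
  have m0 : 0 <= m.+1%:R^-1 :> R by rewrite invr_ge0.
  have := test_leZ m0 (test_le_sin mom ab).
  apply: test_le_weaken; rewrite /k -!mulrA mulKf// (mulrC m.+1%:R).
  by rewrite !mulrA.
pose g (j : nat) t := om * (b - a) + 2 * \sum_(m < j) h m t.
have hg j : test_le (g j) (B om * (b - a)).
  have c0 : 0 <= om * (b - a) by rewrite mulr_ge0// ltW.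
  apply: test_le_weaken (test_leD (test_le_cst c0)
    (test_leZ (ler0n _ 2) (test_le_sum j hk))).
  have -> : \sum_(m < j) k m = om * (b - a) * (2 * C) *
      \sum_(m < j) (1 + om * m.+1%:R) `^ (- alpha).
    by rewrite mulr_sumr; apply: eq_bigr => m _; rewrite /k mulrA.
  have := sum_powR_le j om0 alpha_gt1; set s := \sum_(m < j) _; rewrite /B.
  set y := (om * (alpha - 1))^-1 => sle.
  rewrite [leRHS](_ : _ = om * (b - a) * `|\int[mu]_t f t| +
    2 * (om * (b - a) * (2 * C) * y)); last ring.
  by rewrite lerD2l ler_wpM2l// ler_wpM2l// mulr_ge0// mulr_ge0.
have n0 : 0 <= n.+1%:R^-1 :> R by rewrite invr_ge0.
have := test_leZ n0 (test_le_sum n.+1 hg).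
rewrite big_const_ord iter_addr_0 -[_ * _ *+ _]mulr_natl mulKf//.
rewrite (_ : (fun t => _ * _) = (fun t =>
  fejer_step n (om * (b - t)) - fejer_step n (om * (a - t))))//.
apply/funext => t; rewrite /fejer_step -mulrBr /fejer_primitive -sumrB.
congr (_ * _); apply: eq_bigr => j _.
rewrite opprD addrACA -(mulrBr 2) -sumrB /g.
congr (_ + _ * _); first ring.
by apply: eq_bigr => m _; rewrite /h mulrBr !mulrA.
Qed.

Hypothesis S_ge0 : 0 <= S.

(** This frequency keeps [om * (c - t)] in [[-pi, pi]], where [fejer_step] converges, for [t] in the
    support and [c] up to 1 beyond it. *)
Let om : R := pi / (S + 1).

Let om_gt0 : 0 < om.
Proof. by rewrite divr_gt0 ?pi_gt0// ltr_wpDl. Qed.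

Let omS (c t : R) : -1 <= c <= S + 1 -> 0 <= t <= S -> `|om * (c - t)| <= pi.
Proof.
move=> /andP[c1 cS] /andP[t0 tS]; rewrite normrM gtr0_norm//.
rewrite /om mulrAC ler_pdivrMr ?ltr_wpDl// ler_wpM2l ?pi_ge0//.
by rewrite ler_norml; apply/andP; split; lra.
Qed.

(** The difference of two shifted steps tends to [2 * pi] inside the interval and to 0 outside, so
    dominated convergence carries the uniform bound of [test_le_fejer] over to the integral of
    [f]. *)
Lemma Rintegral_itv_le (a b : R) : -1 <= a -> a < b -> b <= S + 1 ->
  `|\int[mu]_(t in `]a, b]) f t| <= B om / (2 * pi) * (b - a).
Proof.
move=> a1 ab bS.
have a1S : -1 <= a <= S + 1 by apply/andP; split; lra.
have b1S : -1 <= b <= S + 1 by apply/andP; split; lra.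
pose F n t := f t * (fejer_step n (om * (b - t)) - fejer_step n (om * (a - t))).
pose G t := f t * (Num.sg (b - t) * pi - Num.sg (a - t) * pi).
have FG t : F n t @[n --> \oo] --> G t.
  have [ft0|/f_supp tS] := eqVneq (f t) 0.
    rewrite /F /G ft0 mul0r (_ : (fun n => _) = cst 0); first exact: cvg_cst.
    by apply/funext => n; rewrite mul0r.
  have sg_om c : Num.sg (c - t) = Num.sg (om * (c - t)).
    by rewrite sgrM (gtr0_sg om_gt0) mul1r.
  by apply: cvgMr; rewrite !sg_om; apply: cvgB; apply: cvg_fejer_step_sg;
    exact: omS.
have iF n : mu.-integrable setT (EFin \o F n).
  by have [] := test_le_fejer n om_gt0 (ltW ab).
have mf : measurable_fun setT f by apply/measurable_EFinP;
  case/integrableP: f_int.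
have Fle n t : `|F n t| <= 2 * pi * `|f t|.
  have [ft0|/f_supp tS] := eqVneq (f t) 0.
    by rewrite /F ft0 mul0r normr0 mulr0.
  rewrite /F normrM mulrC ler_wpM2r// (le_trans (ler_normB _ _))//.
  by rewrite mulr_natl mulr2n lerD// fejer_step_norm_le ?omS.
have icvg : (\int[mu]_t (F n t)%:E @[n --> \oo] --> \int[mu]_t (G t)%:E)%E.
  apply: (@dominated_cvg _ _ _ mu setT measurableT (fun n => EFin \o F n)
    (EFin \o G) (fun t => (2 * pi * `|f t|)%:E)).
  - by move=> n; case/integrableP: (iF n).
  - by move=> t _ /=; apply/cvg_EFin; [exact: nearW|exact: FG].
  - by [].
  - exact: (integrableZl measurableT (2 * pi) (integrable_norm f_int)).
  - by move=> n t _ /=; rewrite lee_fin.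
have fS (i : interval R) : mu.-integrable [set` i] (EFin \o f).
  by apply: (integrableS measurableT) f_int.
(* The limit takes the value [pi] at the endpoints, so it is [pi] times the sum of the open and
   closed indicators. *)
pose f1 := f \_ `]a, b[; pose f2 := f \_ `[a, b].
have if1 : mu.-integrable setT (EFin \o f1).
  rewrite -restrict_EFin; exact: (integrable_mkcond _ _).1 (fS _).
have if2 : mu.-integrable setT (EFin \o f2).
  rewrite -restrict_EFin; exact: (integrable_mkcond _ _).1 (fS _).
have GE t : G t = pi * (f1 t + f2 t).
  rewrite /G /f1 /f2 !patchE (_ : point = 0)//.
  have [ta|ta|ta] := ltrgtP t a.
  - rewrite !memNset/= ?in_itv/=; last 2 first.
      by rewrite leNgt ta.
      by rewrite ltNge (ltW ta).
    rewrite !gtr0_sg ?subr_gt0//; last exact: lt_trans ab.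
    by ring.
  - have [tb|tb|tb] := ltrgtP t b.
    + rewrite !mem_set/= ?in_itv/= ?ta ?tb ?(ltW ta) ?(ltW tb)//.
      rewrite gtr0_sg ?subr_gt0// ltr0_sg ?subr_lt0//; ring.
    + rewrite !memNset/= ?in_itv/= ?(ltNge t b) ?(leNgt t b) ?tb ?(ltW tb)
      ?andbF//.
      by rewrite !ltr0_sg ?subr_lt0//; ring.
    + rewrite memNset ?mem_set/= ?in_itv/= -?tb ?ltxx ?lexx ?andbF ?(ltW ta)//.
      by rewrite subrr sgr0 ltr0_sg ?subr_lt0//; ring.
  - rewrite memNset ?mem_set/= ?in_itv/= ta ?ltxx ?lexx ?(ltW ab)//.
    by rewrite subrr sgr0 gtr0_sg ?subr_gt0//; ring.
have iGE : (\int[mu]_t (G t)%:E =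
    (2 * pi * \int[mu]_(t in `]a, b]) f t)%:E)%E.
  have ifoc : mu.-integrable `]a, b] (EFin \o f) by exact: fS.
  have ifoo : mu.-integrable `]a, b[ (EFin \o f) by exact: fS.
  have iG : mu.-integrable setT (EFin \o G).
    rewrite (_ : EFin \o G = EFin \o (fun t => pi * (f1 t + f2 t))).
      exact: (integrableZl measurableT pi (integrableD measurableT if1 if2)).
    by apply/funext => t /=; rewrite GE.
  rewrite -[LHS]fineK; last exact: (integrable_fin_num measurableT iG).
  congr EFin; rewrite -/(Rintegral mu setT G).
  rewrite (@eq_Rintegral _ _ _ mu setT (fun t => pi * (f1 t + f2 t)));
    last by move=> t _; exact: GE.
  rewrite RintegralZl//; last exact: (integrableD measurableT if1 if2).
  rewrite RintegralD// -!Rintegral_mkcond.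
  rewrite -Rintegral_itv_obnd_cbnd// Rintegral_itv_bndo_bndc//.
  by ring.
rewrite iGE in icvg.
have rcvg : `|\int[mu]_t F n t| @[n --> \oo] -->
    `|2 * pi * \int[mu]_(t in `]a, b]) f t|.
  by apply: cvg_norm; exact: (fine_cvg icvg).
have pi2 : 0 < 2 * pi :> R by rewrite mulr_gt0// pi_gt0.
rewrite mulrAC ler_pdivlMr// mulrC -[X in X * _](gtr0_norm pi2) -normrM.
apply: (ler_cvg_to rcvg (cvg_cst (B om * (b - a)))); apply: nearW => n.
by have [_] := test_le_fejer n om_gt0 (ltW ab).
Qed.

End fourier_bound.

(** At almost every point [f] is the derivative of its indefinite integral, whose difference
    quotients are bounded by [K]. *)
Lemma ae_bounded_of_Rintegral_itv {R : realType} (f : R -> R) (a b K : R) :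
  (@lebesgue_measure R).-integrable setT (EFin \o f) ->
  (forall x y, a <= x -> x < y -> y <= b ->
    `|\int[@lebesgue_measure R]_(t in `]x, y]) f t| <= K * (y - x)) ->
  {ae (@lebesgue_measure R), forall t, a < t < b -> `|f t| <= K}.
Proof.
move=> fi fK.
have fS (i : interval R) : (@lebesgue_measure R).-integrable [set` i]
  (EFin \o f).
  by apply: (integrableS measurableT) fi.
have lf : locally_integrable setT f.
  by have := integrable_locally measurableT fi; rewrite patch_setT.
have := FTC1Ny (fun y => fS _) lf.
apply: filterS; first exact: (ae_filter_ringOfSetsType lebesgue_measure).
move=> x [dF F'] /andP[ax xb].
set F := (fun y => _) in dF F'.
have Fdiff y z : y < z -> F z - F y = \int[lebesgue_measure]_(t in `]y, z]) f t.
  by move=> yz; rewrite /F Rintegral_itvB// bnd_simp; exact: ltW.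
have lim : h^-1 *: (F (h + x) - F x) @[h --> 0^'] --> f x.
  rewrite -F' /derive1.
  rewrite (_ : (fun h => _) = (fun h =>
    h^-1 *: ((F \o shift x) (h *: 1) - F x))).
    exact: dF.
  by apply/funext => h; rewrite /= [_%:A]mulr1.
apply: (ler_cvg_to (cvg_norm lim) (cvg_cst K)).
have e0 : 0 < Num.min (x - a) (b - x) by rewrite lt_min !subr_gt0 ax xb.
near=> h.
have h0 : h != 0 by near: h; exact: nbhs_dnbhs_neq.
have /andP[ahx hxb] : a <= h + x <= b.
  have : `|h| < Num.min (x - a) (b - x) by near: h; exact: dnbhs0_lt.
  by rewrite lt_min !ltr_norml => /andP[/andP[? ?] /andP[? ?]]; apply/andP; lra.
rewrite normrM normfV mulrC ler_pdivrMr ?normr_gt0//.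
have [hp|hn|/eqP] := ltrgtP h 0; last by rewrite (negbTE h0).
  rewrite distrC Fdiff ?gtrDr//.
  apply: (@le_trans _ _ (K * (x - (h + x)))); first by apply: fK; lra.
  by rewrite ler0_norm ?(ltW hp)//; lra.
rewrite Fdiff ?ltrDr//.
apply: (@le_trans _ _ (K * (h + x - x))); first by apply: fK; lra.
by rewrite ger0_norm ?(ltW hn)//; lra.
Unshelve. all: by end_near.
Qed.

(** * Integrability of the wavelet filter coefficients *)

(** A supremum equal to [-oo], as for an empty family, is allowed too; the bound is then 0. *)
Lemma ereal_sup_lty_ub {R : realType} (A : set (\bar R)) :
  (ereal_sup A < +oo)%E ->
  exists2 C : R, 0 <= C & forall x, A x -> (x <= C%:E)%E.
Proof.
move=> Alty; have ub x : A x -> (x <= ereal_sup A)%E by exact: ereal_sup_ubound.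
move: Alty ub; case: (ereal_sup A) => [r _ ub|//|_ ub].
  exists (Num.max r 0) => [|x /ub xr]; first by rewrite le_max lexx orbT.
  by rewrite (le_trans xr)// lee_fin le_max lexx.
by exists 0 => // x /ub; rewrite leeNy_eq => /eqP ->; rewrite leNye.
Qed.

Lemma integrableM_ae_bounded {R : realType} d (T : measurableType d)
    (mu : {measure set T -> \bar R}) (g f : T -> R) (K : R) :
  mu.-integrable setT (EFin \o g) -> measurable_fun setT f ->
  {ae mu, forall t, `|f t| <= K} ->
  mu.-integrable setT (EFin \o (fun t => g t * f t)).
Proof.
move=> gi mf fK.
have mg : measurable_fun setT g by apply/measurable_EFinP; case/integrableP: gi.
apply/integrableP; split; first exact/measurable_EFinP/measurable_funM.
have /integrableP[_] : mu.-integrable setT (EFin \o (fun t => K * g t)).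
  exact: (integrableZl measurableT K gi).
apply: le_lt_trans; apply: ae_ge0_le_integral => //.
- by apply: measurableT_comp => //; exact/measurable_EFinP/measurable_funM.
- by apply: measurableT_comp => //; exact/measurable_EFinP/measurable_funM.
- apply: filterS fK => t ftK _ /=; rewrite lee_fin !normrM mulrC.
  by rewrite ler_wpM2r// (le_trans ftK)// ler_norm.
Qed.

Lemma normc_ge_Re_Im {R : rcfType} (x y : R) :
  `|x| <= ComplexField.Normc.normc (x +i* y)%C /\
  `|y| <= ComplexField.Normc.normc (x +i* y)%C.
Proof.
split; rewrite /= -sqrtr_sqr ler_sqrt ?lerDl ?lerDr ?sqr_ge0//.
  by rewrite addr_ge0 ?sqr_ge0.
by rewrite addr_ge0 ?sqr_ge0.
Qed.

Section wavelet_pair.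
Context {R : realType}.
Notation mu := (@lebesgue_measure R).
Variables (phi psi : R -> R) (M : nat) (alpha : R) (T : nat).
Hypothesis wp : admissible_wavelet_pair phi psi M alpha T.

Lemma psi_ae_bounded : exists K, {ae mu, forall t, `|psi t| <= K}.
Proof.
have [C C0 HC] := ereal_sup_lty_ub (awp_psi_decay wp).
have decay xi : 0 <= xi ->
    ComplexField.Normc.normc (fourier psi xi) <= C * (1 + xi) `^ (- alpha).
  move=> xi0; rewrite powRN ler_pdivlMr ?powR_gt0 ?ltr_wpDr//.
  rewrite -lee_fin; apply: HC; exists xi => //.
  by rewrite ger0_norm.
have fourierE xi : fourier psi xi = ((\int[mu]_t (psi t * cos (xi * t))) +i*
    (\int[mu]_t (psi t * sin (- (xi * t)))))%C.
  rewrite /fourier /cintegral; congr (_ +i* _)%C; apply: eq_Rintegral => t _.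
    by rewrite /cexp/= mul0r subr0 cosN.
  by rewrite /cexp/= mul0r addr0.
have T0 : 0 <= T%:R :> R by [].
have psi_cos xi : 0 <= xi ->
    `|\int[mu]_t (psi t * cos (xi * t))| <= C * (1 + xi) `^ (- alpha).
  move=> /decay; apply: le_trans; rewrite fourierE.
  by have [] := normc_ge_Re_Im (\int[mu]_t (psi t * cos (xi * t)))
    (\int[mu]_t (psi t * sin (- (xi * t)))).
have psi_sin xi : 0 <= xi ->
    `|\int[mu]_t (psi t * sin (xi * t))| <= C * (1 + xi) `^ (- alpha).
  move=> /decay; apply: le_trans; rewrite fourierE.
  have [_] := normc_ge_Re_Im (\int[mu]_t (psi t * cos (xi * t)))
    (\int[mu]_t (psi t * sin (- (xi * t)))).
  apply: le_trans; rewrite -normrN -mulN1r -RintegralZl//.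
    rewrite le_eqVlt; apply/orP; left; apply/eqP; congr `|_|.
    by apply: eq_Rintegral => t _; rewrite sinN mulN1r mulrN.
  apply: (integrableM_bounded (awp_psi_int wp) (awp_psi_supp wp) (k := 1)).
    apply: measurableT_comp; last exact: measurable_funM.
    by apply: continuous_measurable_fun => x; exact: continuous_sin.
  by move=> t _; exact: sin_max.
have [K HK] : exists K, forall x y, -1 <= x -> x < y -> y <= T%:R + 1 ->
    `|\int[mu]_(t in `]x, y]) psi t| <= K * (y - x).
  eexists => x y; exact: (Rintegral_itv_le (awp_psi_int wp) (awp_psi_supp wp)
    (awp_alpha wp) psi_cos psi_sin T0).
(* The absolute value makes the bound hold off the support as well. The margin of 1 puts the whole
   support, endpoints included, inside the interval of differentiation. *)
exists `|K|; have := ae_bounded_of_Rintegral_itv (awp_psi_int wp) HK.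
apply: filterS; first exact: (ae_filter_ringOfSetsType lebesgue_measure).
move=> t tK; have [->|/(awp_psi_supp wp)/andP[t0 tT]] := eqVneq (psi t) 0.
  by rewrite normr0.
rewrite (le_trans (tK _)) ?ler_norm//; apply/andP; split; lra.
Qed.

(** In the variable [u = 2^-j t - k] the product is an affine copy of [phi], integrable, times
    [psi], essentially bounded. *)
Lemma integrable_phi_psi (j : nat) (k l : int) :
  mu.-integrable setT (EFin \o (fun t => phi (t - l%:~R) * psijk psi j k t)).
Proof.
have [K psiK] := psi_ae_bounded.
have j0 : 0 < 2^-1 ^+ j :> R by rewrite exprn_gt0.
have j20 : 0 < 2 ^+ j :> R by rewrite exprn_gt0.
have mpsi : measurable_fun setT psi.
  by apply/measurable_EFinP; case/integrableP: (awp_psi_int wp).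
have phi_aff := integrable_affine (2 ^+ j * k%:~R - l%:~R) j20 (awp_phi_int wp).
have := integrable_affine (- k%:~R) j0
  (integrableM_ae_bounded phi_aff mpsi psiK).
move=> /(integrableZl measurableT (2 `^ (- (j%:R / 2)))).
apply: eq_integrable => // t _ /=; congr EFin.
rewrite /psijk mulrCA; congr (phi _ * _).
by rewrite mulrBr addrA subrK mulrA -exprMn divff// expr1n mul1r.
Qed.

End wavelet_pair.

(** * Wavelet coefficients as filters of the differenced process *)

Lemma sum_by_parts {R : comNzRingType} (c x : nat -> R) n :
  \sum_(l < n) c l * x l =
  \sum_(l < n) (- \sum_(i < l.+1) c i) * (x l.+1 - x l) +
  (\sum_(l < n) c l) * x n.
Proof.
elim: n => [|n IH]; first by rewrite !big_ord0 mul0r addr0.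
rewrite big_ord_recr IH /= [in RHS]big_ord_recr /=.
rewrite (big_ord_recr n)/=; ring.
Qed.

Lemma ffact_horner {R : comNzRingType} m : exists2 p : {poly R},
  (size p <= m.+1)%N & forall l : nat, p.[l%:R] = (l ^_ m)%:R.
Proof.
elim: m => [|m [p ps pE]].
  by exists 1; [rewrite size_poly1|move=> l; rewrite hornerC ffactn0].
exists (p * ('X - m%:R%:P)).
  by rewrite (leq_trans (size_polyMleq _ _))// size_XsubC addn2.
move=> l; rewrite hornerM pE hornerXsubC ffactnSr natrM.
have [ml|lm] := leqP m l; first by rewrite natrB.
by rewrite ffact_small// !mul0r.
Qed.

(** [m! * 'C(l, m)] is the value at [l] of a polynomial of degree at most [m]. *)
Lemma binomial_moments {R : numFieldType} (c : nat -> R) M n :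
  (forall m, (m < M)%N -> \sum_(l < n) c l * l%:R ^+ m = 0) ->
  forall m, (m < M)%N -> \sum_(l < n) c l * 'C(l, m)%:R = 0.
Proof.
move=> c0 m mM; have [p ps pE] := @ffact_horner R m.
have mf : m`!%:R != 0 :> R by rewrite pnatr_eq0 -lt0n fact_gt0.
apply: (mulIf mf); rewrite mul0r mulr_suml.
transitivity (\sum_(l < n) \sum_(i < size p) p`_i * (c l * l%:R ^+ i)).
  apply: eq_bigr => l _;
    rewrite -mulrA -natrM bin_ffact -pE horner_coef mulr_sumr.
  by apply: eq_bigr => i _; rewrite mulrCA.
rewrite exchange_big big1//= => i _.
by rewrite -mulr_sumr c0 ?mulr0// (leq_trans (ltn_ord i))// (leq_trans ps).
Qed.

(* The moments are expressed in the binomial basis because summation by parts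
   turns 'C(l, m.+1) into 'C(l, m). *)
Lemma filter_backward_diff {R : realType} {d} {Omega : measurableType d} M
    (c : nat -> R) n :
  (forall m, (m < M)%N -> \sum_(l < n) c l * 'C(l, m)%:R = 0) ->
  exists e : nat -> R, forall (Y : int -> Omega -> R) (s : int) w,
    \sum_(l < n) c l * Y (s + l%:Z) w =
    \sum_(l < n) e l * iter M backward_diff Y (s + M%:Z + l%:Z) w.
Proof.
elim: M c => [|M IH] c c0.
  by exists c => Y s w; rewrite addr0.
pose c' l := - \sum_(i < l.+1) c i.
have sc0 : \sum_(l < n) c l = 0.
  rewrite -[RHS](c0 0%N)//; apply: eq_bigr => l _.
  by rewrite bin0 mulr1.
have [m mM|e eE] := IH c'.
  rewrite -[RHS](c0 m.+1)// (sum_by_parts c (fun l => 'C(l, m.+1)%:R)).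
  rewrite sc0 mul0r addr0; apply: eq_bigr => l _.
  by rewrite binS natrD addrAC subrr add0r.
exists e => Y s w.
rewrite (sum_by_parts c (fun l => Y (s + l%:Z) w)) sc0 mul0r addr0.
transitivity (\sum_(l < n) c' l * backward_diff Y (s + 1 + l%:Z) w).
  apply: eq_bigr => l _; congr (_ * (Y _ w - Y _ w)); lia.
rewrite eE; apply: eq_bigr => l _; rewrite iterSr.
by have -> : s + 1 + M%:Z + l%:Z = s + M.+1%:Z + l%:Z by lia.
Qed.

Lemma Rintegral_sum {R : realType} d (T : measurableType d)
    (mu : {measure set T -> \bar R}) n (a : nat -> R) (f : nat -> T -> R) :
  (forall i, mu.-integrable setT (EFin \o f i)) ->
  mu.-integrable setT (EFin \o (fun t => \sum_(i < n) a i * f i t)) /\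
  \int[mu]_t (\sum_(i < n) a i * f i t) = \sum_(i < n) a i * \int[mu]_t f i t.
Proof.
move=> fi; elim: n => [|n [IHi IHe]].
  under eq_fun do rewrite big_ord0.
  rewrite big_ord0; split; first exact: integrable0.
  by rewrite Rintegral_cst// mul0r.
rewrite big_ord_recr/= -IHe; under eq_fun do rewrite big_ord_recr/=.
have fin := integrableZl measurableT (a n) (fi n).
split; first exact: (integrableD measurableT IHi fin).
by rewrite RintegralD// RintegralZl.
Qed.

Section wavelet_filter.
Context {R : realType}.
Notation mu := (@lebesgue_measure R).
Variables (phi psi : R -> R) (M : nat) (alpha : R) (T : nat).
Hypothesis wp : admissible_wavelet_pair phi psi M alpha T.
Variable j : nat.

Definition wfilter (l : nat) : R :=
  \int[mu]_t (phi (t - l%:R) * psijk psi j 0 t).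

(** For [t] in the support of [psijk psi j 0], within [[0, 2^j T]], the function [phi (t - l)]
    vanishes unless [t <= l <= t + T]. Hence [l] runs from 0 to [2^j T + T] inclusive. *)
Definition wfilter_size := (2 ^ j * T + T).+1.

Lemma psij0_supp t : psijk psi j 0 t != 0 -> 0 <= t <= 2 ^+ j * T%:R.
Proof.
rewrite /psijk mulf_eq0 negb_or => /andP[_ /(awp_psi_supp wp)].
have j20 : 0 < 2^-1 ^+ j :> R by rewrite exprn_gt0.
rewrite subr0 exprVn mulrC pmulr_lge0 ?invr_gt0 ?exprn_gt0//.
by rewrite ler_pdivrMr ?exprn_gt0// (mulrC T%:R).
Qed.

Lemma interpolation_finite (y : int -> R) (N : int) s :
  0 <= s <= 2 ^+ j * T%:R ->
  \sum_(k \in [set: int]) y k * phi (s + N%:~R - k%:~R) =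
  \sum_(l < wfilter_size) y (N + l%:Z) * phi (s - l%:R).
Proof.
move=> /andP[s0 sT].
pose r := [seq N + l%:Z | l <- index_iota 0 wfilter_size].
have ur : uniq r by rewrite map_inj_uniq ?iota_uniq// => a b /addrI [].
transitivity (\sum_(k \in [set` r]) y k * phi (s + N%:~R - k%:~R)).
  apply/esym/fsbig_widen => // k [_ /=] kr.
  have [->|/(awp_phi_supp wp)/andP[kl ku]] := eqVneq (phi
    (s + N%:~R - k%:~R)) 0.
    by rewrite mulr0.
  exfalso; apply: kr.
  have Nk : N <= k.
    by rewrite -(ler_int R); lra.
  apply/mapP; exists `|k - N|%N; last by rewrite gez0_abs ?subr_ge0//; lia.
  rewrite mem_index_iota/= /wfilter_size ltnS.
  have : ((k - N)%:~R <= (2 ^ j * T + T)%N%:R :> R).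
    by rewrite natrD natrM natrX intrB; lra.
  by rewrite [leRHS]pmulrn ler_int; lia.
rewrite -fsbig_seq// big_map big_mkord.
apply: eq_bigr => l _; congr (_ * phi _).
by rewrite intrD -pmulrn; ring.
Qed.

Let int_phi_psi l :
  mu.-integrable setT (EFin \o (fun t => phi (t - l%:R) * psijk psi j 0 t)).
Proof. exact: (integrable_phi_psi wp j 0 l%:Z). Qed.

(** Translating by [2^j k] turns [psijk psi j k] into [psijk psi j 0], so one finite filter serves
    every [k]. Outside the support of the wavelet both integrands vanish, whatever the interpolation
    is. *)
Lemma wcoefE d (Omega : measurableType d) (X : int -> Omega -> R) (k : int) w :
  wcoef X phi psi j k w =
  \sum_(l < wfilter_size) wfilter l * X ((2 ^ j)%N%:Z * k + l%:Z) w.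
Proof.
set N := _ * k.
pose h s := \sum_(l < wfilter_size) X (N + l%:Z) w *
  (phi (s - l%:R) * psijk psi j 0 s).
have [hi hE] := Rintegral_sum wfilter_size (fun l =>
  X (N + l%:Z) w) int_phi_psi.
have psiN t : psijk psi j k t = psijk psi j 0 (1 * t + - N%:~R).
  rewrite /psijk mul1r subr0 mulrBr; congr (_ * psi (_ - _)).
  by rewrite /N intrM -pmulrn natrX mulrA -exprMn mulVf// expr1n mul1r.
rewrite /wcoef (@eq_Rintegral _ _ _ mu setT (fun t : R =>
  h (1 * t + - N%:~R))); last first.
  move=> t _; rewrite psiN; set s := 1 * t + _.
  have [p0|/psij0_supp sT] := eqVneq (psijk psi j 0 s) 0.
    by rewrite /h p0 mulr0 big1// => l _; rewrite !mulr0.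
  rewrite /interpolation /h.
  have -> : t = s + N%:~R by rewrite /s; ring.
  rewrite interpolation_finite// mulr_suml.
  by apply: eq_bigr => l _; rewrite mulrA.
rewrite Rintegral_affine// invr1 mul1r hE.
by apply: eq_bigr => l _; rewrite mulrC.
Qed.

(** On the support of the wavelet the sum of [l ^ m * phi (t - l)] is a polynomial of degree [m],
    and the wavelet is orthogonal to such polynomials for [m < M]. *)
Lemma wfilter_moments m : (m < M)%N ->
  \sum_(l < wfilter_size) wfilter l * l%:R ^+ m = 0.
Proof.
move=> mM; have [p [ps pE]] := awp_phi_poly wp mM.
have := Rintegral_sum wfilter_size (fun l => l%:R ^+ m) int_phi_psi.
move=> [_ hE]; transitivity (\sum_(l < wfilter_size) l%:R ^+ m * wfilter l).
  by apply: eq_bigr => l _; rewrite mulrC.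
rewrite -hE.
have j0 : 0 < 2^-1 ^+ j :> R by rewrite exprn_gt0.
have imon i : mu.-integrable setT (EFin \o (fun t => t ^+ i * psi t)).
  rewrite (_ : (fun t => _) = (fun t => psi t * t ^+ i)); last first.
    by apply/funext => t; rewrite mulrC.
  apply: (integrableM_bounded (awp_psi_int wp) (awp_psi_supp wp)
    (k := T%:R ^+ i)).
    exact: measurable_funX.
  by move=> t /andP[t0 tT];
    rewrite normrX ger0_norm// lerXn2r// nnegrE (le_trans t0).
pose g i t := (2^-1 ^+ j * t + 0) ^+ i * psi (2^-1 ^+ j * t + 0).
have gi i : mu.-integrable setT (EFin \o g i)
  by exact: (integrable_affine 0 j0 (imon i)).
have gE i : (i < M)%N -> \int[mu]_t g i t = 0.
  by move=> iM; rewrite (Rintegral_affine 0 j0 (imon i))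
    (awp_psi_moments wp)// mulr0.
(* Coefficients of [p] in powers of [2^-j t], with the wavelet normalization included. *)
pose a i := 2 `^ (- (j%:R / 2)) * (p`_i * 2 ^+ j ^+ i).
have [_ gsE] := Rintegral_sum (size p) a gi.
transitivity (\int[mu]_t (\sum_(i < size p) a i * g i t)).
  apply: eq_Rintegral => t _.
  have [p0|/psij0_supp sT] := eqVneq (psijk psi j 0 t) 0.
    rewrite big1 => [|l _]; last by rewrite p0 !mulr0.
    rewrite big1// => i _; rewrite /a /g.
    move: p0; rewrite /psijk subr0 addr0 => /eqP; rewrite mulf_eq0.
    by rewrite powR_eq0 /= pnatr_eq0/= => /eqP ->; rewrite !mulr0.
  transitivity (p.[t] * psijk psi j 0 t).
    rewrite -pE; under eq_fsbigr do rewrite -[t in phi (t - _)](addr0 t).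
    rewrite (@interpolation_finite (fun k => k%:~R ^+ m) 0)// mulr_suml.
    by apply: eq_bigr => l _; rewrite mulrA add0r.
  rewrite horner_coef mulr_suml; apply: eq_bigr => i _.
  rewrite /a /g /psijk subr0 addr0.
  have -> : t ^+ i = 2 ^+ j ^+ i * (2^-1 ^+ j * t) ^+ i.
    by rewrite -exprMn mulrA -exprMn divff// expr1n mul1r.
  by ring.
rewrite gsE big1// => i _.
by rewrite gE ?mulr0// (leq_trans (ltn_ord i))// ps.
Qed.

End wavelet_filter.

(** * Second moments of the wavelet coefficients *)

Section second_moments.
Context {R : realType} {d : measure_display} {Omega : measurableType d}.
Variable P : probability Omega R.

Lemma integrable_mul_Lfun2 (f g : Omega -> R) :
  f \in Lfun P 2%:E -> g \in Lfun P 2%:E ->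
  P.-integrable setT (EFin \o (fun w => f w * g w)).
Proof. by move=> f2 g2; apply/Lfun1_integrable; exact: Lfun2_mul_Lfun1. Qed.

(** The mean product is the covariance plus the product of the means. Stationarity applies to the
    covariance at lag [a - b], from the base points [k + b] and [b]. *)
Lemma covariance_stationary_second_moment (Y : int -> Omega -> R)
  (k a b : int) :
  covariance_stationary P Y ->
  \int[P]_w (Y (k + a) w * Y (k + b) w) = \int[P]_w (Y a w * Y b w).
Proof.
move=> [Y2 EY covY].
have Y1 i : Y i \in Lfun P 1 by apply: Lfun_subset12 => //;
  exact: fin_num_measure.
have rE i j : \int[P]_w (Y i w * Y j w) =
    fine (covariance P (Y i) (Y j)) + fine ('E_P[Y i] * 'E_P[Y j])%E.
  have ij : Y i * Y j \in Lfun P 1 by exact: Lfun2_mul_Lfun1.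
  have Efin i' : ('E_P[Y i'])%E \is a fin_num by exact: expectation_fin_num.
  rewrite -fineD ?fin_numM//; last exact: covariance_fin_num.
  rewrite covarianceE// subeK ?fin_numM//.
  by rewrite unlock.
rewrite !rE (EY (k + a) a) (EY (k + b) b); congr (fine _ + _).
have := covY (k + b) b (a - b).
have -> : k + b + (a - b) = k + a by rewrite -addrA (addrC b) subrK.
by have -> : b + (a - b) = a by rewrite addrC subrK.
Qed.

Lemma second_moment_sum n (e : nat -> R) (f : nat -> Omega -> R) :
  (forall l, f l \in Lfun P 2%:E) ->
  P.-integrable setT (EFin \o (fun w => (\sum_(l < n) e l * f l w) ^+ 2)) /\
  \int[P]_w ((\sum_(l < n) e l * f l w) ^+ 2) =
  \sum_(l < n) e l * \sum_(m < n) e m * \int[P]_w (f l w * f m w).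
Proof.
move=> f2.
have fi l := Rintegral_sum n e (fun m => integrable_mul_Lfun2 (f2 l) (f2 m)).
have [gi gE] := Rintegral_sum n e (fun l => (fi l).1).
rewrite (_ : (fun w => _) = (fun w =>
  \sum_(l < n) e l * \sum_(m < n) e m * (f l w * f m w))); last first.
  apply/funext => w; rewrite expr2 mulr_suml; apply: eq_bigr => l _.
  rewrite -mulrA mulr_sumr; congr (_ * _); apply: eq_bigr => m _.
  by rewrite mulrCA.
split=> //; rewrite gE; apply: eq_bigr => l _.
by rewrite (fi l).2.
Qed.

Lemma variance_centered (Y : Omega -> R) : ('E_P[Y] = 0)%E ->
  'V_P[Y] = (\int[P]_w (Y w ^+ 2)%:E)%E.
Proof.
move=> EY; rewrite /variance unlock EY/= unlock.
by apply: eq_integral => w _ /=; rewrite !fctE/= subr0 expr2.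
Qed.

Variables (X : int -> Omega -> R) (d0 : R).
Variable nustar : {measure set (measurableTypeR R) -> \bar R}.
Variables (phi psi : R -> R) (M : nat) (alpha : R) (T : nat).
Hypothesis X_memory : has_memory_parameter P X d0 nustar.
Hypothesis wp : admissible_wavelet_pair phi psi M alpha T.
Hypothesis M_large : d0 - 2^-1 < M%:R.
Hypothesis W_centered : forall j k, ('E_P[wcoef X phi psi j k] = 0)%E.

(** The coefficient is a finite filter of the [M]-th difference of [X], stationary because
    [M > d0 - 1/2]. The index [k] only shifts all times together, so the value agrees with the one
    at [k = 0], which defines [wvar]. *)
Lemma wcoef_second_moment j k :
  P.-integrable setT (EFin \o (fun w => wcoef X phi psi j k w ^+ 2)) /\
  \int[P]_w (wcoef X phi psi j k w ^+ 2) = wvar P X phi psi j.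
Proof.
have [_ _ _ /(_ M M_large)[mu [_ [statY _ _ _]]]] := X_memory.
have [Y2 _ _] := statY; set Y := iter M _ X in statY Y2.
have [e eE] := @filter_backward_diff R d Omega M _ _
  (binomial_moments (wfilter_moments wp j)).
have WE k' w : wcoef X phi psi j k' w = \sum_(l < wfilter_size T j)
    e l * Y ((2 ^ j)%N%:Z * k' + M%:Z + l%:Z) w.
  by rewrite (wcoefE wp) eE.
have key k' :
    P.-integrable setT (EFin \o (fun w => wcoef X phi psi j k' w ^+ 2)) /\
    \int[P]_w (wcoef X phi psi j k' w ^+ 2) =
    \sum_(l < wfilter_size T j) e l * \sum_(m < wfilter_size T j)
      e m * \int[P]_w (Y l%:Z w * Y m%:Z w).
  have [gi gE] := @second_moment_sum (wfilter_size T j) e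
    (fun l => Y ((2 ^ j)%N%:Z * k' + M%:Z + l%:Z)) (fun l => Y2 _).
  rewrite (_ : (fun w => _) = (fun w => (\sum_(l < wfilter_size T j)
    e l * Y ((2 ^ j)%N%:Z * k' + M%:Z + l%:Z) w) ^+ 2)); last first.
    by apply/funext => w; rewrite WE.
  split=> //; rewrite gE; apply: eq_bigr => l _; congr (_ * _).
  by apply: eq_bigr => m _;
    rewrite (covariance_stationary_second_moment _ _ _ statY).
split; first by have [] := key k.
have wvarE : wvar P X phi psi j = \int[P]_w (wcoef X phi psi j 0 w ^+ 2).
  by rewrite /wvar variance_centered.
by rewrite wvarE (key k).2 (key 0).2.
Qed.

End second_moments.

(** * Sample sizes per scale *)

Section counting.
Variables T n : nat.
Hypothesis T_gt0 : (0 < T)%N.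

Lemma ncoef_le j : (ncoef T n j * 2 ^ j <= n)%N.
Proof.
rewrite /ncoef; set a : rat := _ - _ + 1.
have j20 : 0 < 2 ^+ j :> rat by rewrite exprn_gt0.
have [a0|a0] := leP 0 a;
  last by rewrite (truncn0Pn _ _) ?mul0n// -ltNge (lt_trans a0).
have /andP[ta _] := truncn_itv a0.
rewrite -(ler_nat rat) natrM natrX -ler_pdivlMr// (le_trans ta)//.
have T1 : 1 <= T%:R :> rat by rewrite ler1n.
rewrite /a exprVn mulrC.
have : (n%:R - T%:R + 1) / 2 ^+ j <= n%:R / 2 ^+ j :> rat.
  by rewrite ler_pM2r ?invr_gt0//; lra.
lra.
Qed.

(** With [ncoef_le] this locates [ncoef T n j] between [(n - T) / 2^j - T] and [n / 2^j]. *)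
Lemma ncoef_gt j : (n < 2 ^ j * (ncoef T n j + T) + T)%N.
Proof.
rewrite -(ltr_nat rat) !(natrD, natrM, natrX).
have j20 : 0 < 2 ^+ j :> rat by rewrite exprn_gt0.
have := truncnS_gt (2^-1 ^+ j * (n%:R - T%:R + 1) - T%:R + 1 : rat).
rewrite -/(ncoef T n j) exprVn mulrC -natr1 => h.
have : (n%:R - T%:R + 1) / 2 ^+ j < (ncoef T n j)%:R + T%:R :> rat by lra.
rewrite ltr_pdivrMr// mulrC; lra.
Qed.

End counting.

Lemma big_Iset {R : comNzRingType} (T n L U : nat) (F : nat * nat -> R) :
  \sum_(p <- Iset T n L U) F p =
  \sum_(L <= j < U.+1) \sum_(k < ncoef T n j) F (j, k : nat).
Proof.
pose s := [seq (j, k) | j <- index_iota L U.+1, k <- index_iota 0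
  (ncoef T n j)].
have us : uniq s.
  apply: allpairs_uniq_dep => [|j _|]; rewrite ?iota_uniq//.
  by move=> [i x] [j y] _ _ [-> /= ->].
rewrite (perm_big s)/=; last first.
  by apply: uniq_perm; rewrite ?fset_uniq// => p; rewrite !inE.
rewrite big_allpairs_dep; apply: eq_bigr => j _.
by rewrite big_mkord.
Qed.

Lemma card_Iset {R : numDomainType} (T n L U : nat) :
  (#|` Iset T n L U|%fset)%:R = \sum_(L <= j < U.+1) (ncoef T n j)%:R :> R.
Proof.
have := @big_Iset R T n L U (fun=> 1).
rewrite big_const_seq iter_addr_0 count_predT => ->.
by apply: eq_bigr => j _; rewrite big_const_ord iter_addr_0.
Qed.

(** * Two elementary inequalities *)

Lemma sum_arith_geometric {R : realFieldType}
  (c q : R) n : 0 <= c -> 0 <= q < 1 ->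
  \sum_(m < n) (c + m%:R) * q ^+ m <= c / (1 - q) + q / (1 - q) ^+ 2.
Proof.
move=> c0 /andP[q0 q1].
(* [r m * q ^+ m] is the tail of the infinite series from index [m] on. *)
pose r m := (c + m%:R) / (1 - q) + q / (1 - q) ^+ 2.
have q1' : 1 - q != 0 by rewrite subr_eq0 eq_sym lt_eqF.
have q1p : 0 < 1 - q by rewrite subr_gt0.
have -> : \sum_(m < n) (c + m%:R) * q ^+ m = r 0%N - r n * q ^+ n.
  elim: n => [|n IH]; first by rewrite big_ord0 expr0 mulr1 subrr.
  by rewrite big_ord_recr/= IH /r -(natr1 n) (exprS q n); field.
have r0 m : 0 <= r m.
  apply: addr_ge0; apply: divr_ge0 => //; last exact/exprn_ge0/ltW.
    exact: addr_ge0.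
  exact: ltW.
by rewrite [r 0%N]/r addr0 gerBl mulr_ge0// exprn_ge0.
Qed.

(** For [x >= -2], square [1 + x / 2 <= expR (x / 2)]. For [x < -2] the left-hand side is at most
    [1 + x / 2], which is negative; the linear branch of the minimum is there for this range. *)
Lemma expR_ge_min {R : realType} (x : R) :
  1 + x + Num.min (`|x| / 2) (x ^+ 2 / 4) <= expR x.
Proof.
have [x2|x2] := leP (- 2) x.
  have xE : x = x / 2 + x / 2 by rewrite -splitr.
  rewrite [in leRHS]xE expRD.
  have h : 0 <= 1 + x / 2 by lra.
  have e := expR_ge1Dx (x / 2).
  apply: (@le_trans _ _ ((1 + x / 2) * (1 + x / 2))); last by rewrite ler_pM.
  apply: (@le_trans _ _ (1 + x + x ^+ 2 / 4));
    first by rewrite lerD2l ge_min lexx orbT.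
  by rewrite le_eqVlt; apply/orP; left; apply/eqP; field.
apply: le_trans (expR_ge0 x).
apply: (@le_trans _ _ (1 + x + `|x| / 2)); first by rewrite lerD2l ge_min lexx.
by rewrite ltr0_norm; lra.
Qed.

(** * Location of the minimizers *)

Section argmin_location.
Context {R : realType}.

(** A minimizer over the compact interval around [c] is global, since outside it [G] exceeds
    [G c]. *)
Lemma argmin_ln_within (G : R -> R) (c t : R) : 0 <= t -> continuous G ->
  (forall x, 0 < G x) -> (forall x, t < `|x - c| -> G c < G x) ->
  argmin (@ln R \o G) !=set0 /\
  forall x, argmin (@ln R \o G) x -> `|x - c| <= t.
Proof.
move=> t0 cG G0 Gc; split; last first.
  move=> x /(_ c)/=; rewrite ler_ln ?posrE// => Gxc.
  by rewrite leNgt; apply/negP => /Gc; rewrite ltNge Gxc.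
have ct : c - t <= c + t by rewrite lerD2l ge0_cp.
have [x _ xmin] := EVT_min ct (continuous_subspaceT cG).
exists x => y /=; rewrite ler_ln ?posrE//.
have cin : c \in `[c - t, c + t] by rewrite in_itv/= gerBl lerDl t0.
have [yt|ty] := leP `|y - c| t; last first.
  exact: le_trans (xmin _ cin) (ltW (Gc _ ty)).
by apply: xmin; rewrite in_itv/= -ler_distl.
Qed.

Lemma powR2E (x : R) : 2 `^ x = expR (x * ln 2).
Proof. by rewrite /powR pnatr_eq0. Qed.

Lemma ln2_ge_half : 2^-1 <= ln 2 :> R.
Proof.
have : ln (1 + - 2^-1) <= - 2^-1 :> R by apply: le_ln1Dx; lra.
have -> : 1 + - 2^-1 = 2^-1 :> R by lra.
by rewrite lnV ?posrE// lerN2.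
Qed.

(** The linear terms weighted by [N] cancel, so only [B - N] contributes at first order; the
    convexity gain at scale [L] outweighs it. *)
Lemma exp_sum_gt (L U : nat) (B N : nat -> R) (m a x : R) : (L <= U)%N ->
  (forall j, 0 <= B j) -> \sum_(L <= j < U.+1) N j * (m - j%:R) = 0 ->
  `|a * x| * \sum_(L <= j < U.+1) `|B j - N j| * `|m - j%:R| <
    B L * Num.min (`|a * x * (m - L%:R)| / 2) ((a * x * (m - L%:R)) ^+ 2 / 4) ->
  \sum_(L <= j < U.+1) B j <
  \sum_(L <= j < U.+1) expR (a * x * (m - j%:R)) * B j.
Proof.
move=> LU B0 N0.
set mL := Num.min _ _ => small.
pose z (j : nat) := a * x * (m - j%:R).
apply: (@lt_le_trans _ _ (\sum_(L <= j < U.+1) (1 + z j) * B j + mL * B L)).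
  have -> : \sum_(L <= j < U.+1) (1 + z j) * B j =
      \sum_(L <= j < U.+1) B j + \sum_(L <= j < U.+1) (B j - N j) * z j.
    transitivity (\sum_(L <= j < U.+1) B j + \sum_(L <= j < U.+1)
      (B j - N j) * z j
        + a * x * \sum_(L <= j < U.+1) N j * (m - j%:R)).
      rewrite mulr_sumr -!big_split/=; apply: eq_bigr => j _.
      by rewrite /z; ring.
    by rewrite N0 mulr0 addr0.
  rewrite -addrA ltrDl mulrC -ltrBlDl sub0r (le_lt_trans _ small)//.
  apply: le_trans (ler_norm _) _; rewrite normrN.
  apply: le_trans (ler_norm_sum _ _ _) _.
  rewrite mulr_sumr; apply: ler_sum => j _.
  by rewrite /z normrM (normrM (a * x)) mulrCA.
rewrite !(@big_ltn _ _ _ L) ?ltnS// addrAC -mulrDl lerD//.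
  by rewrite ler_wpM2r// expR_ge_min.
by apply: ler_sum => j _; rewrite ler_wpM2r// expR_ge1Dx.
Qed.

End argmin_location.

(** * The contrast in terms of scale energies *)

Section contrast_at.
Context {R : realType}.
Variables (T n L U : nat) (y : nat -> nat -> R).
Local Notation I := (Iset T n L U).
Local Notation m := (mean_scale (R := R) I).

Definition contrast_sum (x : R) : R :=
  \sum_(p <- I) 2 `^ (2 * x * (m - p.1%:R)) * y p.1 p.2 ^+ 2.

Lemma contrastE : contrast I y = @ln R \o contrast_sum.
Proof. by []. Qed.

Lemma continuous_contrast_sum : continuous contrast_sum.
Proof.
have -> : contrast_sum = fun x => \sum_(p <- I)
    expR (2 * (m - p.1%:R) * ln 2 * x) * y p.1 p.2 ^+ 2.
  apply/funext => x; apply: eq_bigr => p _; rewrite powR2E.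
  by congr (expR _ * _); ring.
have cexp (c : R) : continuous (fun x : R => expR (c * x)).
  move=> x; have cx : {for x, continuous ( *%R c)} by exact: mulrl_continuous.
  by have := continuous_comp cx (@continuous_expR R _).
apply: (@continuous_big R _ +%R 0 xpredT add_continuous R) => p _ x.
exact: (cvgMl (cexp _ x)).
Qed.

Variables (d0 s2 : R).
Hypothesis s2_gt0 : 0 < s2.

(** Normalization by the model variance [s2 * 2^(2 d0 j)], rather than by the true one, makes the
    contrast factor exactly around [d0]. *)
Definition scale_energy (j : nat) : R :=
  \sum_(k < ncoef T n j) y j k ^+ 2 / (s2 * 2 `^ (2 * d0 * j%:R)).

Lemma scale_energy_ge0 j : 0 <= scale_energy j.
Proof.
apply: sumr_ge0 => k _; rewrite mulr_ge0 ?sqr_ge0// invr_ge0.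
by rewrite mulr_ge0 ?powR_ge0// ltW.
Qed.

(** The prefactor is positive and free of [x], so contrasts compare as the exponential sums do. *)
Lemma contrast_sumD x : contrast_sum (d0 + x) = s2 * 2 `^ (2 * d0 * m) *
  \sum_(L <= j < U.+1) expR (2 * ln 2 * x * (m - j%:R)) * scale_energy j.
Proof.
rewrite /contrast_sum big_Iset mulr_sumr; apply: eq_bigr => j _.
rewrite /scale_energy !mulr_sumr; apply: eq_bigr => k _ /=.
have p0 : 0 < 2 `^ (2 * d0 * j%:R) :> R by rewrite powR_gt0.
have -> : 2 `^ (2 * (d0 + x) * (m - j%:R)) = 2 `^ (2 * d0 * m) *
    expR (2 * ln 2 * x * (m - j%:R)) / 2 `^ (2 * d0 * j%:R).
  rewrite !powR2E -expRN -!expRD; congr expR; ring.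
by field; rewrite !gt_eqF.
Qed.

Lemma sum_scale_centered : (0 < #|` I|%fset)%N ->
  \sum_(L <= j < U.+1) (ncoef T n j)%:R * (m - j%:R) = 0.
Proof.
move=> I0; have IN0 : (#|` I|%fset)%:R != 0 :> R by rewrite pnatr_eq0 -lt0n.
under eq_bigr do rewrite mulrBr.
rewrite sumrB -mulr_suml -card_Iset /mean_scale mulVKf//.
rewrite big_Iset; apply/eqP; rewrite subr_eq0; apply/eqP; apply: eq_bigr => j _.
by rewrite /= big_const_ord iter_addr_0 mulr_natl.
Qed.

End contrast_at.

(** * Second moment of a scale energy around its sample size *)

Section energy_fluctuation.
Context {R : realType} {d : measure_display} {Omega : measurableType d}.
Variable P : probability Omega R.

(** With [r = v / c] and [S] the energy normalized by [v], of mean [N], the deviation [r S - N]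
    splits into the fluctuation [r (S - N)] and the bias [(r - 1) N]. The variance stays in the
    extended reals, as it may be infinite here. *)
Lemma energy_second_moment (W : nat -> Omega -> R) (N : nat) (v c : R) :
  v != 0 -> c != 0 -> (forall k, measurable_fun setT (W k)) ->
  (forall k, P.-integrable setT (EFin \o (fun w => W k w ^+ 2))) ->
  (forall k, \int[P]_w (W k w ^+ 2) = v) ->
  (\int[P]_w ((\sum_(k < N) W k w ^+ 2 / c - N%:R) ^+ 2)%:E <=
    (2 * (v / c) ^+ 2)%:E * 'V_P[fun w => (\sum_(k < N) W k w ^+ 2 / v)%R] +
    (2 * ((v / c - 1) * N%:R) ^+ 2)%:E)%E.
Proof.
move=> v0 c0 mW iW EW.
pose S w := \sum_(k < N) W k w ^+ 2 / v.
have mS : measurable_fun setT S.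
  apply: measurable_sum => k; apply: measurable_funM => //.
  exact: measurable_funX.
have SE w : S w = \sum_(k < N) v^-1 * W k w ^+ 2.
  by apply: eq_bigr => k _; rewrite mulrC.
have [iS ES] := Rintegral_sum N (fun=> v^-1) iW.
have ESN : fine ('E_P[S])%E = N%:R.
  rewrite unlock -/(Rintegral P setT S) (_ : S = fun w =>
    \sum_(k < N) v^-1 * W k w ^+ 2).
    rewrite ES (eq_bigr (fun=> 1)); last by move=> k _; rewrite EW mulVf.
    by rewrite big_const_ord iter_addr_0.
  exact/funext.
have -> : ('V_P[S] = \int[P]_w ((S w - N%:R) ^+ 2)%:E)%E.
  rewrite /variance unlock ESN unlock.
  by apply: eq_integral => w _ /=; rewrite !fctE/= expr2.
have -> : ((2 * ((v / c - 1) * N%:R) ^+ 2)%:E =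
    \int[P]_w (2 * ((v / c - 1) * N%:R) ^+ 2)%:E)%E.
  by rewrite integral_cst//= probability_setT mule1.
have mSN : measurable_fun setT (EFin \o (fun w => (S w - N%:R) ^+ 2)).
  by apply/measurable_EFinP/measurable_funX; exact: measurable_funB.
rewrite -ge0_integralZl//; last first.
- by rewrite lee_fin mulr_ge0// sqr_ge0.
- by move=> w _; rewrite lee_fin sqr_ge0.
rewrite -ge0_integralD//; last first.
- by move=> w _; rewrite lee_fin mulr_ge0// sqr_ge0.
- exact: measurable_funeM.
- by move=> w _; rewrite mule_ge0// lee_fin ?sqr_ge0// mulr_ge0// sqr_ge0.
apply: ge0_le_integral => //.
- by move=> w _; rewrite lee_fin sqr_ge0.
- apply/measurable_EFinP/measurable_funX; apply: measurable_funB => //.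
  apply: measurable_sum => k; apply: measurable_funM => //.
  exact: measurable_funX.
- by apply: emeasurable_funD => //; exact: measurable_funeM.
move=> w _; rewrite -EFinM -EFinD lee_fin.
have -> : \sum_(k < N) W k w ^+ 2 / c = v / c * S w.
  rewrite mulr_sumr; apply: eq_bigr => k _; field; exact/andP.
set r := v / c; set s := S w.
have -> : r * s - N%:R = r * (s - N%:R) + (r - 1) * N%:R by ring.
set p := s - _; set q := (r - 1) * _.
have -> : 2 * r ^+ 2 * p ^+ 2 + 2 * q ^+ 2 = (r * p + q) ^+ 2 +
  (r * p - q) ^+ 2 by ring.
by rewrite lerDl sqr_ge0.
Qed.

End energy_fluctuation.

(** * Geometric decay of the sample sizes and location of the minimizers *)

Section sample_size.
Context {R : realType}.
Variables T n L U : nat.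
Hypothesis T_gt0 : (0 < T)%N.
Hypothesis LU : (L < U)%N.
Local Notation x := (n%:R / 2 ^+ L : R).
Hypothesis x_large : 8 * T%:R <= x.
Local Notation I := (Iset T n L U).
Local Notation N j := ((ncoef T n j)%:R : R).

Let L2 : 0 < 2 ^+ L :> R.
Proof. by rewrite exprn_gt0. Qed.

Let T1 : 1 <= T%:R :> R.
Proof. by rewrite ler1n. Qed.

Let x0 : 0 < x.
Proof. by apply: lt_le_trans x_large;
  rewrite mulr_gt0// (lt_le_trans ltr01). Qed.

Lemma ncoef_le_geometric m : N (m + L) <= x * 2^-1 ^+ m.
Proof.
have m2 : 0 < 2 ^+ m :> R by rewrite exprn_gt0.
rewrite exprVn ler_pdivlMr// ler_pdivlMr// -mulrA -exprD.
by rewrite -natrX -natrM ler_nat ncoef_le.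
Qed.

Lemma ncoef_ge_geometric m : x <= 2 ^+ m * (N (m + L) + T%:R) + T%:R.
Proof.
rewrite ler_pdivrMr//.
have := ncoef_gt T n (m + L) => /ltnW.
rewrite -(ler_nat R) !(natrD, natrM, natrX) exprD => h.
apply: (le_trans h); rewrite (mulrDl _ _ (2 ^+ L)) mulrAC lerD2l.
by rewrite ler_peMr// exprn_ege1// ler1n.
Qed.

Let N0 : x / 2 <= N L.
Proof. by have := ncoef_ge_geometric 0; rewrite add0n expr0 mul1r;
  move: x_large x0; lra. Qed.

Let N1 : x / 4 <= N L.+1.
Proof. by have := ncoef_ge_geometric 1; rewrite add1n expr1;
  move: x_large x0 T1; lra. Qed.

Let shift (F : nat -> R) :
  \sum_(L <= j < U.+1) F j = \sum_(m < U.+1 - L) F (m + L)%N.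
Proof. by rewrite -{1}(add0n L) big_addn big_mkord. Qed.

Lemma card_Iset_bounds : x / 2 <= #|` I|%fset%:R <= 2 * x.
Proof.
rewrite card_Iset; apply/andP; split.
  rewrite big_ltn; last by rewrite ltnS ltnW.
  by apply: (le_trans N0); rewrite lerDl sumr_ge0.
rewrite shift; apply: (@le_trans _ _ (\sum_(m < U.+1 - L) x * 2^-1 ^+ m)).
  by apply: ler_sum => m _; exact: ncoef_le_geometric.
rewrite -mulr_sumr mulrC ler_pM2r//.
have -> : \sum_(m < U.+1 - L) 2^-1 ^+ m = 2 - 2 * 2^-1 ^+ (U.+1 - L) :> R.
  elim: (U.+1 - L)%N => [|k IH]; first by rewrite big_ord0; lra.
  by rewrite big_ord_recr/= IH exprS; lra.
by rewrite gerBl mulr_ge0// exprn_ge0.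
Qed.

(** Scale [L.+1], present because [L < U], contributes at least [x / 4] to the sum of
    [m * N (m + L)], against a cardinal of at most [2 * x]. Above, that sum is at most [x] times the
    sum of [m / 2^m], which is 2, against a cardinal of at least [x / 2]. *)
Lemma mean_scale_bounds : 8^-1 <= mean_scale (R := R) I - L%:R <= 4.
Proof.
have /andP[cl cu] := card_Iset_bounds.
have c0 : 0 < #|` I|%fset%:R :> R by move: cl x0; lra.
have -> : mean_scale (R := R) I - L%:R =
    (\sum_(m < U.+1 - L) N (m + L) * m%:R) / #|` I|%fset%:R.
  have -> : \sum_(m < U.+1 - L) N (m + L) * m%:R =
      \sum_(L <= j < U.+1) N j * j%:R - L%:R * #|` I|%fset%:R.
    rewrite card_Iset !shift mulr_sumr -sumrB; apply: eq_bigr => m _.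
    by rewrite natrD; ring.
  rewrite mulrBl mulfK ?gt_eqF// /mean_scale mulrC big_Iset; congr (_ / _ - _).
  by apply: eq_bigr => j _; rewrite /= big_const_ord iter_addr_0 mulr_natl.
apply/andP; split.
  rewrite ler_pdivlMr//; apply: (@le_trans _ _ (x / 4)); first by move: cu; lra.
  apply: (le_trans N1).
  have [k ->] : exists k, (U.+1 - L = k.+2)%N by exists (U - L).-1; lia.
  rewrite !big_ord_recl/= mulr0 add0r mulr1 lerDl.
  by rewrite sumr_ge0// => i _; rewrite mulr_ge0.
rewrite ler_pdivrMr//; apply: (@le_trans _ _ (x * 2)); last by move: cl; lra.
apply: (@le_trans _ _ (\sum_(m < U.+1 - L) x * ((0 + m%:R) * 2^-1 ^+ m))).
  apply: ler_sum => m _; rewrite add0r (mulrC m%:R) mulrA.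
  by rewrite ler_wpM2r// ncoef_le_geometric.
rewrite -mulr_sumr ler_pM2l//.
have q01 : (0 <= (2^-1 : R)) && ((2^-1 : R) < 1).
  by rewrite invr_ge0 ler0n/= invf_lt1// ltr1n.
apply: (le_trans (sum_arith_geometric _ (lexx 0) q01)).
by rewrite le_eqVlt; apply/orP; left; apply/eqP; field.
Qed.

Section location.
Variables (y : nat -> nat -> R) (d0 s2 t : R).
Hypothesis s2_gt0 : 0 < s2.
Hypothesis t_bounds : 0 < t <= 8.

Let D j := scale_energy T n y d0 s2 j - N j.

Hypothesis D_small :
  \sum_(L <= j < U.+1) (4 + (j - L)%N%:R) * `|D j| < x * t / 1024.

(** Deviations [u] beyond [t] are excluded by [exp_sum_gt]: the weights [4 + (j - L)] dominate
    [|m - j|], and the distance of [m] from [L] keeps the convexity gain at scale [L] away from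
    0. *)
Lemma contrast_argmin_within :
  argmin (contrast I y) !=set0 /\
  forall z, argmin (contrast I y) z -> `|z - d0| <= t.
Proof.
have /andP[t0 t8] := t_bounds.
have /andP[m8 m4] := mean_scale_bounds; set m := mean_scale _ in m8 m4.
have /andP[cl _] := card_Iset_bounds.
have I0 : (0 < #|` I|%fset)%N by rewrite -(ltr_nat R); move: cl x0; lra.
have Dle := D_small; set Q := \sum_(_ <= _ < _) _ in Dle.
have Q4 : 4 * `|D L| <= Q.
  rewrite /Q big_ltn; last by rewrite ltnS ltnW.
  by rewrite subnn addr0 lerDl sumr_ge0.
have x8 : x * t <= x * 8 by rewrite ler_pM2l.
(* Here [t <= 8] gives [|D L| <= x / 512], against [N L >= x / 2]. *)
have BL : x / 4 <= scale_energy T n y d0 s2 L.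
  have : - `|D L| <= D L by rewrite lerNl -normrN ler_norm.
  by rewrite {2}/D; move: N0 x0; lra.
have BL0 : 0 < scale_energy T n y d0 s2 L by move: BL x0; lra.
have K0 : 0 < s2 * 2 `^ (2 * d0 * m) by rewrite mulr_gt0// powR_gt0.
have sum_exp_gt0 z : 0 < \sum_(L <= j < U.+1)
    expR (2 * ln 2 * z * (m - j%:R)) * scale_energy T n y d0 s2 j.
  rewrite big_ltn; last by rewrite ltnS ltnW.
  rewrite ltr_wpDr ?mulr_gt0 ?expR_gt0// sumr_ge0// => j _.
  by rewrite mulr_ge0 ?expR_ge0 ?scale_energy_ge0.
rewrite contrastE; apply: argmin_ln_within (ltW t0) _ _ _.
- exact: continuous_contrast_sum.
- move=> z; have -> : z = d0 + (z - d0) by rewrite addrC subrK.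
  by rewrite (contrast_sumD _ _ _ _ _ _ s2_gt0) mulr_gt0.
move=> z tz; have zE : z = d0 + (z - d0) by rewrite addrC subrK.
rewrite zE -[X in contrast_sum _ _ _ _ _ X < _](addr0 d0).
rewrite !(contrast_sumD _ _ _ _ _ _ s2_gt0) ltr_pM2l//.
set u := z - d0 in tz *.
rewrite (eq_bigr (fun j => scale_energy T n y d0 s2 j)); last first.
  by move=> j _; rewrite mulr0 mul0r expR0 mul1r.
have a1 : 1 <= 2 * ln 2 :> R by have := @ln2_ge_half R; lra.
apply: (@exp_sum_gt _ _ _ _ (fun j => N j)) => //.
- exact: ltnW.
- by move=> j; exact: scale_energy_ge0.
- exact: sum_scale_centered.
set A := `|2 * ln 2 * u|.
have tA : t < A.
  apply: (lt_le_trans tz); rewrite /A normrM ler_peMl// ger0_norm//.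
  by apply: le_trans a1.
have A0 : 0 < A by exact: lt_trans tA.
apply: (@le_lt_trans _ _ (A * Q)).
  rewrite ler_pM2l// ler_sum_nat// => j /andP[Lj jU]; rewrite mulrC ler_wpM2r//.
  rewrite natrB//.
  have -> : m - j%:R = (m - L%:R) - (j%:R - L%:R) by ring.
  apply: (le_trans (ler_normB _ _)); rewrite lerD//.
    by rewrite ger0_norm//; lra.
  by rewrite ger0_norm// subr_ge0 ler_nat.
(* As [m - L >= 1/8], the exponent at scale [L] is at least [A / 8] in absolute value, which gives
   the two entries of the minimum. Multiplied by [x / 4] they become [A * x / 64] and
   [A ^+ 2 * x / 1024]; [A * Q] is below the first because [t <= 8], and below the second because
   [t < A]. *)
apply: (@lt_le_trans _ _ (x / 4 * Num.min (A / 16) (A ^+ 2 / 256))); last first.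
  have x4 : 0 <= x / 4 by rewrite divr_ge0 ?ler0n// ltW.
  have A256 : 0 <= Num.min (A / 16) (A ^+ 2 / 256).
    by rewrite le_min !divr_ge0 ?ler0n ?sqr_ge0 ?(ltW A0).
  apply: ler_pM x4 A256 BL _.
  have Am : A / 8 <= `|2 * ln 2 * u * (m - L%:R)|.
    by rewrite normrM ler_pM2l// ger0_norm//; lra.
  rewrite le_min !ge_min; apply/andP; split.
    by apply/orP; left; move: Am; lra.
  apply/orP; right; rewrite -[X in _ <= X / 4]real_normK ?num_real//.
  have : (A / 8) ^+ 2 <= `|2 * ln 2 * u * (m - L%:R)| ^+ 2.
    by rewrite lerXn2r// nnegrE// divr_ge0// ltW.
  by rewrite expr_div_n; lra.
rewrite -ltr_pdivrMl; last by rewrite divr_gt0.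
rewrite lt_min; apply/andP; split.
  rewrite ltr_pdivrMl; last by rewrite divr_gt0.
  rewrite [ltRHS](_ : _ = A * (x / 64)); last by field.
  by rewrite ltr_pM2l//; move: Dle x8 x0; lra.
rewrite ltr_pdivrMl; last by rewrite divr_gt0.
rewrite [ltRHS](_ : _ = A * (x * A / 1024)); last by field.
rewrite ltr_pM2l//; apply: (lt_trans Dle).
have i1024 : 0 < 1024^-1 :> R by rewrite invr_gt0 ltr0n.
by rewrite (ltr_pM2r i1024) (ltr_pM2l x0).
Qed.

End location.

End sample_size.

(** * Fluctuations of the empirical scale energies *)

Section fluctuation_bound.
Context {R : realType} {d : measure_display} {Omega : measurableType d}.
Variable P : probability Omega R.

(** The bias is at most 1/2, so [v / c <= 2] and the variance term costs at most [8 * C2]; the bias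
    term costs [2 * C1 ^+ 2]. Both multiply quantities bounded by the square of [sqrt N + N b]. *)
Lemma fluctuation_le (W : nat -> Omega -> R) (N : nat) (v c b C1 C2 : R) :
  0 < v -> 0 < c -> (forall k, measurable_fun setT (W k)) ->
  (forall k, P.-integrable setT (EFin \o (fun w => W k w ^+ 2))) ->
  (forall k, \int[P]_w (W k w ^+ 2) = v) ->
  0 <= b -> 0 <= C2 -> `|v / c - 1| <= C1 * b -> C1 * b <= 2^-1 ->
  (((1 + N%:R * b ^+ 2)^-1 * N%:R^-1)%:E *
    'V_P[fun w => (\sum_(k < N) W k w ^+ 2 / v)%R] <= C2%:E)%E ->
  (\int[P]_w ((\sum_(k < N) W k w ^+ 2 / c - N%:R) ^+ 2)%:E <=
    ((8 * C2 + 2 * C1 ^+ 2) * (Num.sqrt N%:R + N%:R * b) ^+ 2)%:E)%E.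
Proof.
move=> v0 c0 mW iW EW b0 C20 C1b Cb VC.
(* For [N = 0] the inverse in the variance hypothesis is 0 and gives no information, but the sum is
   empty. *)
have [->|N0] := eqVneq N 0%N.
  under eq_integral do rewrite big_ord0 subr0 expr0n/=.
  by rewrite integral0 lee_fin mulr_ge0// ?sqr_ge0// addr_ge0// mulr_ge0//
    sqr_ge0.
have Np : 0 < N%:R :> R by rewrite ltr0n lt0n.
apply: le_trans (energy_second_moment N _ _ mW iW EW) _; rewrite ?gt_eqF//.
have Nb0 : 0 < 1 + N%:R * b ^+ 2 by rewrite ltr_pwDl// mulr_ge0// sqr_ge0.
have {}VC : ('V_P[fun w => (\sum_(k < N) W k w ^+ 2 / v)%R] <=
    (N%:R * (1 + N%:R * b ^+ 2) * C2)%:E)%E.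
  by move: VC; rewrite -invfM lee_pdivrMl ?mulr_gt0// -EFinM (mulrC _ N%:R).
have r2 : `|v / c| <= 2.
  rewrite -[v / c](subrK 1) (le_trans (ler_normD _ _))// normr1; lra.
set r := v / c in r2 C1b *.
apply: (@le_trans _ _ (((2 * r ^+ 2) * (N%:R * (1 + N%:R * b ^+ 2) * C2)) +
    2 * ((r - 1) * N%:R) ^+ 2)%:E).
  rewrite EFinD leeD2r// [leRHS]EFinM; apply: lee_wpmul2l => //.
  by rewrite lee_fin mulr_ge0// sqr_ge0.
rewrite lee_fin.
have r4 : r ^+ 2 <= 4.
  rewrite -real_normK ?num_real// (_ : 4 = 2 ^+ 2); last by ring.
  by rewrite lerXn2r// nnegrE.
have rb : (r - 1) ^+ 2 <= C1 ^+ 2 * b ^+ 2.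
  rewrite -exprMn -real_normK ?num_real// lerXn2r// nnegrE//.
  exact: le_trans C1b.
have sN : Num.sqrt N%:R ^+ 2 = N%:R :> R by rewrite sqr_sqrtr.
set q := N%:R * (1 + N%:R * b ^+ 2).
have q0 : 0 <= q by rewrite mulr_ge0// ltW.
have qs : q <= (Num.sqrt N%:R + N%:R * b) ^+ 2.
  rewrite sqrrD sN /q mulrDr mulr1 exprMn mulrA -expr2.
  by rewrite -addrA lerD2l lerDr mulrn_wge0// mulr_ge0 ?sqrtr_ge0// mulr_ge0.
have Nbs : N%:R ^+ 2 * b ^+ 2 <= (Num.sqrt N%:R + N%:R * b) ^+ 2.
  apply: le_trans qs; rewrite /q mulrDr mulr1 mulrA -expr2 lerDr; exact: ltW.
rewrite [leRHS]mulrDl lerD//.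
  apply: (@le_trans _ _ (2 * 4 * (q * C2))).
    by apply: ler_wpM2r; [exact: mulr_ge0|exact: ler_wpM2l].
  rewrite [leLHS](_ : _ = 8 * C2 * q); last by ring.
  by rewrite ler_wpM2l// mulr_ge0.
rewrite exprMn -mulrA ler_wpM2l//.
apply: (@le_trans _ _ (C1 ^+ 2 * b ^+ 2 * N%:R ^+ 2)).
  by rewrite ler_wpM2r// sqr_ge0.
by rewrite -mulrA ler_wpM2l ?sqr_ge0// mulrC.
Qed.

End fluctuation_bound.

Section weighted_fluctuation.
Context {R : realType} {d : measure_display} {Omega : measurableType d}.
Variable P : probability Omega R.

Let q : R := Num.sqrt 2^-1.

Let q01 : 0 <= q < 1.
Proof.
rewrite sqrtr_ge0/= -sqrtr1 ltr_sqrt// invf_lt1//; first by rewrite ltr1n.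
Qed.

Let qX m : (q ^+ m) ^+ 2 = 2^-1 ^+ m.
Proof. by rewrite -exprM mulnC exprM sqr_sqrtr// invr_ge0. Qed.

(** The sum of the series [(4 + m) * q ^+ m]; standard deviations decay like [q ^+ m] when sample
    sizes halve. *)
Definition geometric_weight : R := 4 / (1 - q) + q / (1 - q) ^+ 2.

Lemma geometric_weight_ge0 : 0 <= geometric_weight.
Proof.
have /andP[q0 q1] := q01.
by rewrite addr_ge0// divr_ge0// ?exprn_ge0// subr_ge0 ltW.
Qed.

(** With [s = sqrt N + N b], the bound [|D| <= s + D^2 / s] gives a mean absolute deviation of at
    most [(1 + C) s]. Since [s m] decays like [q ^+ m], the weighted sum of the means is controlled
    uniformly in [k], and Markov's inequality concludes. *)
Lemma probability_weighted_sum_le (k : nat) (N b : nat -> R)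
    (D : nat -> Omega -> R) (x B C c : R) :
  0 < c -> 0 <= x -> 0 <= B -> 0 <= C ->
  (forall m, 0 <= N m <= x * 2^-1 ^+ m) -> (forall m, 0 <= b m <= B) ->
  (forall m, measurable_fun setT (D m)) ->
  (forall m w, N m = 0 -> D m w = 0) ->
  (forall m, (m < k)%N -> (\int[P]_w (D m w ^+ 2)%:E <=
    (C * (Num.sqrt (N m) + N m * b m) ^+ 2)%:E)%E) ->
  proba_le P [set w | c <= \sum_(m < k) (4 + m%:R) * `|D m w|]
    ((1 + C) * geometric_weight * (Num.sqrt x + x * B) / c).
Proof.
move=> c0 x0 B0 C0 Nx bB mD D0 DC.
have /andP[q0 q1] := q01.
pose s m := Num.sqrt (N m) + N m * b m.
have N0 m : 0 <= N m by have /andP[] := Nx m.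
have b0 m : 0 <= b m by have /andP[] := bB m.
have s0 m : 0 <= s m by rewrite addr_ge0 ?sqrtr_ge0// mulr_ge0.
have sx m : s m <= (Num.sqrt x + x * B) * q ^+ m.
  have /andP[_ Nm] := Nx m; have /andP[_ bm] := bB m.
  rewrite mulrDl; apply: lerD.
    have -> : q ^+ m = Num.sqrt (2^-1 ^+ m).
      by rewrite -qX sqrtr_sqr ger0_norm// exprn_ge0.
    by rewrite -sqrtrM// ler_wsqrtr.
  have qm : 2^-1 ^+ m <= q ^+ m.
    by rewrite -qX expr2 ler_piMl ?exprn_ge0// exprn_ile1// ltW.
  rewrite mulrAC; apply: ler_pM => //.
  by apply: (le_trans Nm); rewrite ler_wpM2l.
(* Where s m = 0 the junk value of the quotient is harmless: D m = 0 there. *)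
have sD m w : `|D m w| <= s m + D m w ^+ 2 / s m.
  have [/eqP|sm0] := eqVneq (s m) 0.
    rewrite paddr_eq0 ?sqrtr_ge0 ?mulr_ge0// sqrtr_eq0 => /andP[Nm _].
    by rewrite D0 ?normr0 ?expr0n/= ?mul0r ?addr0//; apply/eqP;
      rewrite eq_le Nm N0.
  have sp : 0 < s m by rewrite lt_neqAle eq_sym sm0 s0.
  have : 0 <= (s m - `|D m w|) ^+ 2 / s m by rewrite divr_ge0 ?sqr_ge0.
  have -> : (s m - `|D m w|) ^+ 2 / s m = s m + D m w ^+ 2 / s m - 2 * `|D m w|.
    by rewrite -(real_normK (num_real (D m w))); field.
  have := normr_ge0 (D m w); lra.
pose F m w := (4 + m%:R) * (s m + D m w ^+ 2 / s m).
have F0 m w : 0 <= F m w.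
  by apply: mulr_ge0; apply: addr_ge0 => //; apply: divr_ge0 => //;
    exact: sqr_ge0.
have mF m : measurable_fun setT (F m).
  apply: measurable_funM => //; apply: measurable_funD => //.
  by apply: measurable_funM => //; exact: measurable_funX.
pose Q w := \sum_(m < k) F m w.
have mQ : measurable_fun setT Q by apply: measurable_sum => m; exact: mF.
have Q0 w : 0 <= Q w by apply: sumr_ge0.
have iF m : (m < k)%N -> (\int[P]_w (F m w)%:E <=
    ((1 + C) * ((4 + m%:R) * ((Num.sqrt x + x * B) * q ^+ m)))%:E)%E.
  move=> mk; under eq_integral do rewrite /F EFinM.
  have mDs : measurable_fun setT (fun w => D m w ^+ 2 / s m).
    by apply: measurable_funM => //; exact: measurable_funX.
  have mg : measurable_fun setT (EFin \o (fun w => s m + D m w ^+ 2 / s m)).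
    by apply/measurable_EFinP; exact: measurable_funD.
  rewrite (ge0_integralZl P measurableT mg); last 2 first.
  - move=> w _; rewrite lee_fin; apply: addr_ge0 => //.
    by apply: divr_ge0 => //; exact: sqr_ge0.
  - by rewrite lee_fin addr_ge0.
  apply: (@le_trans _ _ ((4 + m%:R)%:E * ((1 + C) * s m)%:E)%E); last first.
    rewrite -EFinM lee_fin mulrCA ler_wpM2l ?addr_ge0//.
    by rewrite ler_wpM2l ?addr_ge0.
  apply: lee_wpmul2l; first by rewrite lee_fin addr_ge0.
  under eq_integral do rewrite /= EFinD mulrC EFinM.
  rewrite ge0_integralD//; last 3 first.
  - by move=> w _; rewrite lee_fin.
  - by move=> w _; rewrite -EFinM lee_fin mulr_ge0 ?invr_ge0// sqr_ge0.
  - apply: measurable_funeM; exact/measurable_EFinP/measurable_funX.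
  rewrite integral_cst//= probability_setT mule1 mulrDl mul1r (EFinD
    (s m)) leeD2l//.
  have mD2 : measurable_fun setT (EFin \o (fun w => D m w ^+ 2)).
    exact/measurable_EFinP/measurable_funX.
  rewrite (ge0_integralZl P measurableT mD2); last 2 first.
  - by move=> w _; rewrite lee_fin sqr_ge0.
  - by rewrite lee_fin invr_ge0.
  apply: (@le_trans _ _ ((s m)^-1%:E * (C * s m ^+ 2)%:E)%E).
    by apply: lee_wpmul2l; [rewrite lee_fin invr_ge0|exact: DC].
  rewrite -EFinM lee_fin; have [->|sm0] := eqVneq (s m) 0.
    by rewrite invr0 mul0r mulr0.
  by rewrite mulrCA expr2 mulKf.
have iQ : (\int[P]_w (Q w)%:E <=
    ((1 + C) * geometric_weight * (Num.sqrt x + x * B))%:E)%E.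
  under eq_integral do rewrite /Q -sumEFin.
  rewrite ge0_integral_sum//; last 2 first.
  - by move=> m; exact/measurable_EFinP/mF.
  - by move=> m w _; rewrite lee_fin.
  apply: (@le_trans _ _ (\sum_(m < k) ((1 + C) *
      ((4 + m%:R) * ((Num.sqrt x + x * B) * q ^+ m)))%:E)%E).
    by apply: lee_sum => m _; exact: iF.
  rewrite sumEFin lee_fin.
  have -> : \sum_(m < k) (1 + C) * ((4 + m%:R) *
    ((Num.sqrt x + x * B) * q ^+ m)) =
      (1 + C) * (\sum_(m < k) (4 + m%:R) * q ^+ m) * (Num.sqrt x + x * B).
    rewrite mulr_sumr mulr_suml; apply: eq_bigr => m _; ring.
  rewrite ler_wpM2r ?addr_ge0 ?sqrtr_ge0 ?mulr_ge0// ler_wpM2l ?addr_ge0//.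
  by apply: sum_arith_geometric => //; rewrite q0 q1.
(* The event for the majorant [Q] is the measurable cover. *)
exists [set w | c <= Q w]; split.
- rewrite -[X in measurable X]setTI.
  by apply: measurable_fun_le => //; exact: measurable_cst.
- move=> w /= /le_trans; apply; apply: ler_sum => m _.
  by rewrite ler_wpM2l ?addr_ge0.
have markovQ : (c%:E * P [set w | (c <= Q w)%R] <= \int[P]_w (Q w)%:E)%E.
  have mEQ : measurable_fun setT (EFin \o Q) by exact/measurable_EFinP.
  have := @le_integral_comp_abse _ _ _ P setT measurableT (EFin \o Q) c id
    (@measurable_id _ _ _) (fun r r0 => r0) (fun _ _ _ _ h => h) mEQ c0.
  rewrite setTI; under eq_integral do rewrite /= ger0_norm//.
  rewrite (_ : [set w | _] = [set w | (c <= Q w)%R])//.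
  by apply/seteqP; split=> w /=; rewrite lee_fin ger0_norm.
by rewrite mulrC EFinM lee_pdivlMl//; exact: le_trans markovQ iQ.
Qed.

End weighted_fluctuation.

(** * Rates and conclusion *)

Section rates.
Context {R : realType}.
Variable L : nat -> nat.
Local Notation x n := (n%:R / 2 ^+ (L n) : R).
Hypothesis L_rate : (fun n =>
  (((L n)%:R ^+ 2 * (x n) `^ (- 4^-1) : R)%R%:E
    + ((L n)%:R%:E : \bar R)^-1)%E) @ \oo --> (0%E : \bar R).

(** Both summands of the rate are nonnegative, hence small separately. The second makes [L n] large,
    and once [L n >= 1] the first dominates [(x n) ^ (-1/4)], which makes [x n] large. *)
Lemma rate_conditions (K : R) : 0 < K ->
  \forall n \near \oo, K <= (L n)%:R /\ K <= x n.
Proof.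
move=> K0; pose eta := Num.min K^-1 (K `^ (- 4^-1)).
have eta0 : 0 < eta by rewrite lt_min invr_gt0 K0 powR_gt0.
have small : \forall n \near \oo, ((((L n)%:R ^+ 2 * (x n) `^ (- 4^-1) : R)%R%:E
    + ((L n)%:R%:E : \bar R)^-1) < eta%:E)%E.
  suff h : nbhs (0%E : \bar R) [set y | (y < eta%:E)%E].
    exact: L_rate h.
  by apply: open_nbhs_nbhs; split;
    [exact: open_ereal_lt_ereal|rewrite /= lte_fin].
near=> n.
have : ((((L n)%:R ^+ 2 * (x n) `^ (- 4^-1) : R)%R%:E
    + ((L n)%:R%:E : \bar R)^-1) < eta%:E)%E by near: n.
have n0 : (0 < n)%N by near: n; exact: nbhs_infty_gt.
have x0 : 0 < x n by rewrite divr_gt0 ?ltr0n// exprn_gt0.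
(* At [L n = 0] the extended inverse is [+oo], contradicting smallness. *)
have [->|L0] := eqVneq (L n) 0%N.
  by rewrite inve0 addey// ltNge leey.
have L1 : 1 <= (L n)%:R :> R by rewrite ler1n lt0n.
have LN0 : (L n)%:R != 0 :> R by rewrite pnatr_eq0.
rewrite inver (negbTE LN0) -EFinD lte_fin /eta lt_min.
set a := _ ^+ 2 * _; have a0 : 0 <= a by rewrite mulr_ge0 ?sqr_ge0 ?powR_ge0.
have Li : 0 < (L n)%:R^-1 :> R by rewrite invr_gt0 ltr0n lt0n.
move=> /andP[h1 h2]; split.
  by rewrite -lef_pV2 ?posrE ?ltr0n ?lt0n//; lra.
rewrite leNgt; apply/negP => xK.
have : K `^ (- 4^-1) <= (x n) `^ (- 4^-1).
  rewrite !powRN lef_pV2 ?posrE ?powR_gt0//.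
  by rewrite ge0_ler_powR ?nnegrE ?invr_ge0 ?(ltW x0) ?(ltW K0) ?(ltW xK).
have : (x n) `^ (- 4^-1) <= a.
  by rewrite /a ler_peMl ?powR_ge0// exprn_ege1.
lra.
Unshelve. all: by end_near. Qed.

(** From [expR y >= 1 + y] and [ln 2 >= 1/2], the power [2^(beta l)] is at least [1 + beta l / 2],
    hence at least [1 / e] beyond the threshold. *)
Lemma powR2_decay_small (beta : R) (e : R) : 0 < beta -> 0 < e ->
  forall l : nat, 2 / (e * beta) <= l%:R -> 2 `^ (- (beta * l%:R)) <= e.
Proof.
move=> b0 e0 l hl.
rewrite powRN powR2E -[leRHS]invrK lef_pV2 ?posrE ?invr_gt0 ?expR_gt0//.
apply: le_trans (expR_ge1Dx _).
move: hl; rewrite ler_pdivrMr ?mulr_gt0// => hl.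
have h2 : beta * l%:R * 2^-1 <= beta * l%:R * ln 2.
  by rewrite ler_wpM2l ?ln2_ge_half// mulr_ge0// ltW.
rewrite -[leLHS]mul1r ler_pdivrMr//.
have : 2 <= 2 * (beta * l%:R * ln 2 * e).
  apply: (le_trans hl).
  rewrite [leLHS](_ : _ = 2 * (beta * l%:R * 2^-1 * e)); last by field.
  by rewrite ler_pM2l// ler_wpM2r// ltW.
rewrite mulrDl; lra.
Qed.

Lemma sqrt_rate_small (y e : R) : 0 < e -> e ^- 2 <= y -> y `^ (- 2^-1) <= e.
Proof.
move=> e0 ey; have e20 : 0 < e ^- 2 by rewrite invr_gt0 exprn_gt0.
have y0 : 0 < y by exact: lt_le_trans ey.
rewrite powRN powR12_sqrt ?(ltW y0)// -[leRHS]invrK.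
rewrite lef_pV2 ?posrE ?invr_gt0 ?sqrtr_gt0//.
have -> : e^-1 = Num.sqrt (e ^- 2).
  by rewrite -exprVn sqrtr_sqr ger0_norm// invr_ge0 ltW.
exact: ler_wsqrtr.
Qed.

Variables (beta : R).
Hypothesis beta_gt0 : 0 < beta.

Lemma rate_small (e : R) : 0 < e -> \forall n \near \oo,
  (x n) `^ (- 2^-1) + 2 `^ (- (beta * (L n)%:R)) <= e.
Proof.
move=> e0; have e2 : 0 < e / 2 by rewrite divr_gt0.
pose K := Num.max ((e / 2) ^- 2) (2 / (e / 2 * beta)).
have K0 : 0 < K by rewrite lt_max invr_gt0 exprn_gt0.
apply: filterS (rate_conditions K0) => n [].
rewrite !ge_max => /andP[_ hL] /andP[hx _].
by rewrite [leRHS]splitr lerD ?sqrt_rate_small ?powR2_decay_small.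
Qed.

End rates.

Section bigO_to_cvg.
Context {R : realType} {d : measure_display} {Omega : measurableType d}.
Variable P : probability Omega R.

Lemma proba_leS (A B : set Omega) (e f : R) :
  A `<=` B -> e <= f -> proba_le P B e -> proba_le P A f.
Proof.
move=> AB ef [C [mC BC PC]]; exists C; split=> //; first exact: subset_trans BC.
by rewrite (le_trans PC)// lee_fin.
Qed.

Lemma bigO_proba_cvg (Z : nat -> Omega -> R) (r : nat -> R) (l : R) :
  (forall e, 0 < e -> \forall n \near \oo, r n <= e) ->
  bigO_proba P (fun n w => Z n w - l) r -> cvg_proba P Z l.
Proof.
move=> r0 Zr eta e eta0 e0; have [C C0 HC] := Zr e e0.
have Ce : 0 < eta / C by rewrite divr_gt0.
near=> n.
have rn : r n <= eta / C by near: n; exact: r0.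
have : proba_le P [set w | C * r n < `|Z n w - l|] e by near: n.
apply: proba_leS => // w /=; apply: le_lt_trans.
by rewrite mulrC -ler_pdivlMr.
Unshelve. all: by end_near. Qed.

End bigO_to_cvg.

Unset Implicit Arguments.

Theorem theorem3 (R : realType) (d : measure_display)
  (Omega : measurableType d) (P : probability Omega R)
  (X : int -> {RV P >-> R}) (d0 : R)
  (nustar : {measure set (measurableTypeR R) -> \bar R})
  (phi psi : R -> R) (M : nat) (alpha : R) (T : nat)
  (beta sigma2 : R) (L U : nat -> nat) (dhat : nat -> Omega -> R)
  (X_memory : has_memory_parameter P X d0 nustar)
  (wavelet : admissible_wavelet_pair phi psi M alpha T)
  (M_large : d0 - 2^-1 < M%:R)
  (W_centered : forall j k, ('E_P[wcoef X phi psi j k] = 0)%E)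
  (beta_gt0 : 0 < beta) (sigma2_gt0 : 0 < sigma2)
  (bias_bound : (ereal_sup [set x | exists2 j : nat, (1 <= j)%N &
     x = (2 `^ (beta * j%:R) *
          `|wvar P X phi psi j / (sigma2 * 2 `^ (2 * d0 * j%:R)) - 1|)%:E]
     < +oo)%E)
  (var_bound : (ereal_sup [set x | exists n j : nat,
     [/\ (1 <= n)%N, (1 <= j <= Jmax T n)%N &
      x = (((1 + (ncoef T n j)%:R * 2 `^ (- (2 * j%:R * beta)))^-1
             * (ncoef T n j)%:R^-1)%R%:E
          * 'V_P[fun w => (\sum_(k < ncoef T n j)
                   wcoef X phi psi j k%:Z w ^+ 2 / wvar P X phi psi j)%R])%E]]
     < +oo)%E)
  (* L n < U n <= J_n is only possible once J_n >= 1, i.e. for n large. *)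
  (LU : \forall n \near \oo, (L n < U n <= Jmax T n)%N)
  (* Inverse in \bar R, where 0^-1 = +oo. *)
  (L_rate : (fun n =>
      (((L n)%:R ^+ 2 * (n%:R / 2 ^+ L n) `^ (- 4^-1) : R)%R%:E
        + ((L n)%:R%:E : \bar R)^-1)%E) @ \oo --> (0%E : \bar R))
  (dhat_argmin : forall n,
     local_whittle (Iset T n (L n) (U n)) (wcoef X phi psi) (dhat n)) :
  cvg_proba P dhat d0 /\
  bigO_proba P (fun n w => dhat n w - d0)
    (fun n => (n%:R / 2 ^+ L n) `^ (- 2^-1) + 2 `^ (- (beta * (L n)%:R))).
Proof.
suff bigO : bigO_proba P (fun n w => dhat n w - d0)
    (fun n => (n%:R / 2 ^+ L n) `^ (- 2^-1) + 2 `^ (- (beta * (L n)%:R))).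
  by split=> //; apply: bigO_proba_cvg bigO => e e0; exact: rate_small.
have [C1 C10 HC1] := ereal_sup_lty_ub bias_bound.
have [C2 C20 HC2] := ereal_sup_lty_ub var_bound.
pose W := wcoef X phi psi.
pose b (j : nat) : R := 2 `^ (- (beta * j%:R)).
have b0 j : 0 < b j by rewrite powR_gt0.
have bB j m : b (m + j)%N <= b j.
  rewrite /b ler_powR ?ler1n// lerN2 ler_pM2l// ler_nat leq_addl//.
pose c (j : nat) : R := sigma2 * 2 `^ (2 * d0 * j%:R).
have c0 j : 0 < c j by rewrite mulr_gt0// powR_gt0.
pose v := wvar P X phi psi.
have bias j : (1 <= j)%N -> `|v j / c j - 1| <= C1 * b j.
  move=> j1; rewrite /b powRN ler_pdivlMr ?powR_gt0// mulrC -lee_fin.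
  by apply: HC1; exists j.
have T0 := awp_T wavelet.
(* The coefficient is defined by a pathwise integral; its finite filter form makes it measurable. *)
have mW j k : measurable_fun setT (W j k).
  rewrite (_ : W j k = fun w => \sum_(l < wfilter_size T j)
    wfilter phi psi j l * X ((2 ^ j)%N%:Z * k + l%:Z) w); last first.
    by apply/funext => w; rewrite /W (wcoefE wavelet).
  by apply: measurable_sum => l; apply: measurable_funM.
have W2 j k := wcoef_second_moment X_memory wavelet M_large W_centered j k.
pose D n j w := scale_energy T n (fun j k => W j k%:Z w) d0 sigma2 j -
  (ncoef T n j)%:R.
pose C := 8 * C2 + 2 * C1 ^+ 2.
have C0 : 0 <= C by rewrite addr_ge0 ?mulr_ge0// sqr_ge0.
have fluct n j : (1 <= n)%N -> (1 <= j <= Jmax T n)%N -> C1 * b j <= 2^-1 ->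
    (\int[P]_w (D n j w ^+ 2)%:E <= (C *
      (Num.sqrt (ncoef T n j)%:R + (ncoef T n j)%:R * b j) ^+ 2)%:E)%E.
  move=> n1 /andP[j1 jJ] Cb.
  have vc := le_trans (bias j j1) Cb.
  (* Positivity of the wavelet variance follows from a relative bias of at most 1/2. *)
  have v0 : 0 < v j.
    have : 0 < v j / c j by move: vc; rewrite ler_norml => /andP[]; lra.
    by rewrite pmulr_lgt0 ?invr_gt0.
  apply: (@fluctuation_le _ _ _ P (fun k => W j k%:Z) (ncoef T n j) (v j) (c j)
    (b j) C1 C2 v0 (c0 j) _ _ _ (ltW (b0 j)) C20 (bias j j1) Cb).
  - by move=> k; exact: mW.
  - by move=> k; exact: (W2 j k%:Z).1.
  - by move=> k; exact: (W2 j k%:Z).2.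
  have -> : b j ^+ 2 = 2 `^ (- (2 * j%:R * beta)).
    rewrite /b expr2 -powRD ?pnatr_eq0 ?implybT//; congr (_ `^ _); ring.
  by apply: HC2; exists n, j; split=> //; rewrite j1.
have mD n j : measurable_fun setT (D n j).
  apply: measurable_funB => //; apply: measurable_sum => k.
  by apply: measurable_funM => //; exact: measurable_funX.
move=> e e0; pose K := (1 + C) * geometric_weight (R := R).
have K0 : 0 <= K.
  by apply: mulr_ge0; [exact: addr_ge0|exact: geometric_weight_ge0].
(* At threshold [x * (A * r) / 1024] Markov's bound is [1024 * K / A], at most [e] for this [A]; the
   added 1 keeps [A] positive when [K = 0]. *)
pose A := 1024 * K / e + 1.
have k0 : 0 < 1024 :> R by rewrite ltr0n.
have A0 : 0 < A.
  by apply: ltr_wpDl ltr01; exact: divr_ge0 (mulr_ge0 (ltW k0) K0) (ltW e0).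
exists A => //.
have A8 : 0 < 8 / A by rewrite divr_gt0.
(* A rate below this value forces [C1 * b (L n) <= 1/2]; adding 1 covers [C1 = 0]. A rate below
   [8 / A] makes [t = A * r] admissible for the location lemma. *)
have Cb0 : 0 < (2 * (C1 + 1))^-1 by rewrite invr_gt0 mulr_gt0// ltr_wpDl.
have T8 : 0 < 8 * T%:R :> R by rewrite mulr_gt0// ltr0n.
near=> n.
have n1 : (1 <= n)%N by near: n; exact: nbhs_infty_ge.
have /andP[LUn UJn] : (L n < U n <= Jmax T n)%N by near: n.
(* The bias and variance hypotheses only concern scales [j >= 1]. *)
have [L1 _] : 1 <= (L n)%:R :> R /\ 1 <= n%:R / 2 ^+ L n :> R.
  by near: n; exact: (rate_conditions L_rate ltr01).
have [_] : 8 * T%:R <= (L n)%:R :> R /\ 8 * T%:R <= n%:R / 2 ^+ L n :> R.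
  by near: n; exact: (rate_conditions L_rate T8).
have : (n%:R / 2 ^+ L n) `^ (- 2^-1) + 2 `^ (- (beta * (L n)%:R)) <= 8 / A.
  by near: n; exact: (rate_small L_rate beta_gt0).
have : (n%:R / 2 ^+ L n) `^ (- 2^-1) + 2 `^ (- (beta * (L n)%:R)) <=
    (2 * (C1 + 1))^-1.
  by near: n; exact: (rate_small L_rate beta_gt0).
set x := n%:R / 2 ^+ L n; set r := _ + _ => rC rA xT.
have x0 : 0 < x by rewrite divr_gt0 ?ltr0n// exprn_gt0.
have bL : b (L n) <= r by rewrite /r lerDr powR_ge0.
have r0 : 0 < r by exact: lt_le_trans bL.
have CbL : C1 * b (L n) <= 2^-1.
  have C1p : 0 < C1 + 1 by rewrite ltr_wpDl.
  apply: (@le_trans _ _ ((C1 + 1) * (2 * (C1 + 1))^-1)).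
    by apply: ler_pM => //; [exact: ltW|rewrite lerDl|exact: le_trans rC].
  by rewrite invfM mulrCA divff ?gt_eqF// mulr1.
have Ar : 0 < A * r <= 8.
  by rewrite mulr_gt0//= mulrC -ler_pdivlMr.
(* The numerator of Markov's bound is exactly [x] times the announced rate. *)
have xr : x * r = Num.sqrt x + x * b (L n).
  rewrite /r mulrDr (powRN x) powR12_sqrt ?(ltW x0)//; congr (_ + _).
  by rewrite -{1}(sqr_sqrtr (ltW x0)) expr2 mulfK// gt_eqF// sqrtr_gt0.
have thr0 : 0 < x * (A * r) / 1024.
  exact: divr_gt0 (mulr_gt0 x0 (mulr_gt0 A0 r0)) k0.
have /andP[Ar0 Ar8] := Ar.
pose N m : R := (ncoef T n (m + L n))%:R.
have NB m : 0 <= N m <= x * 2^-1 ^+ m.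
  by rewrite /N ler0n/=; exact: ncoef_le_geometric.
have bLB m : 0 <= b (m + L n)%N <= b (L n) by rewrite (ltW (b0 _)) bB.
have DN0 m w : N m = 0 -> D n (m + L n)%N w = 0.
  rewrite /N /D /scale_energy => /eqP; rewrite pnatr_eq0 => /eqP ->.
  by rewrite big_ord0 subrr.
have DC m : (m < (U n).+1 - L n)%N -> (\int[P]_w (D n (m + L n)%N w ^+ 2)%:E <=
    (C * (Num.sqrt (N m) + N m * b (m + L n)%N) ^+ 2)%:E)%E.
  move=> mU; apply: fluct => //.
    rewrite (leq_trans _ UJn) ?andbT; last by rewrite addnC -ltnS -ltn_subRL.
    by rewrite (leq_trans _ (leq_addl _ _))// -(ler_nat R).
  by apply: le_trans CbL; rewrite ler_wpM2l.
have := probability_weighted_sum_le thr0 (ltW x0) (ltW (b0 (L n))) C0 NB bLB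
  (fun m => mD n (m + L n)%N) DN0 DC.
apply: proba_leS; last first.
  rewrite -xr -/K (ler_pdivrMr _ _ thr0).
  have -> : e * (x * (A * r) / 1024) = (e * A / 1024) * (x * r) by field.
  apply: ler_wpM2r (ltW (mulr_gt0 x0 r0)) _ _ _; rewrite /A mulrDr mulr1.
  have -> : e * (1024 * K / e) = 1024 * K by field; rewrite gt_eqF.
  by rewrite (ler_pdivlMr _ _ k0) mulrC lerDl ltW.
(* By contraposition: small fluctuations give existence of a minimizer, so [dhat n w] is one, and
   place it within [A * r] of [d0]. *)
move=> w /= far; rewrite leNgt; apply/negP => small.
have D_small : \sum_(L n <= j < (U n).+1) (4 + (j - L n)%N%:R) * `|D n j w| <
    x * (A * r) / 1024.
  rewrite -{1}(add0n (L n)) big_addn big_mkord.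
  by under eq_bigr do rewrite addnK.
have [ex within] := contrast_argmin_within T0 LUn xT sigma2_gt0 Ar D_small.
move: far; apply/negP; rewrite -leNgt; apply: within.
exact: (dhat_argmin n w ex).
Unshelve. all: by end_near. Qed.
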